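(* Let $S$ be a module-finite algebra over a commutative local noetherian ring $R$ with maximal ideal $\mathfrak{m}$. Let $\widehat{R}$ be the $\mathfrak{m}$-adic completion of $R$, and set $\widehat{S}=S\otimes_R\widehat{R}$. Let $K$ be an idempotent ideal of $\widehat{S}$. Then $K$ is extended from a right $S$-module if and only if there exists an idempotent ideal $J$ of $S$ such that $J\otimes_R\widehat{R}=K$. Moreover, if $K\cong N\otimes_R\widehat{R}$ (as right $\widehat{S}$-modules) for some right $S$-module $N$, then $J=\mathrm{Tr}_S(N)$.
   Context: Ideals are two-sided; $S$ is not necessarily commutative. A right $\widehat{S}$-module $K$ is extended from a right $S$-module if there is a right $S$-module $N$ with $K\cong N\otimes_R\widehat{R}$ as right $\widehat{S}$-modules. By flatness of $\widehat{R}$ over $R$, for an ideal $J$ of $S$ the module $J\otimes_R\widehat{R}$ is identified with its image in $\widehat{S}$, an ideal of $\widehat{S}$. For a right $S$-module $N$, $\mathrm{Tr}_S(N)=\sum_{f\in\mathrm{Hom}_S(N,S)}f(N)$. *)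

(* Defs.v *)
From HB Require Import structures.
From mathcomp Require Import all_boot all_algebra.
From mathcomp Require Import boolp classical_sets.

Set Implicit Arguments.
Unset Strict Implicit.
Unset Printing Implicit Defensive.

Import GRing.Theory.
Local Open Scope classical_set_scope.
Local Open Scope ring_scope.
Local Open Scope quotient_scope.

(* An R-algebra is a ring with a ring morphism from R to its center; unlike
   with algType, the zero ring is allowed. *)
HB.mixin Record isPzAlgebra (R : comPzRingType) S of GRing.PzRing S := {
  alg : {rmorphism R -> S};
  algC : forall (a : R) (x : S), alg a * x = x * alg a
}.

#[short(type="pzAlgType")]
HB.structure Definition PzAlgebra (R : comPzRingType) :=
  {S of GRing.PzRing S & isPzAlgebra R S}.

#[short(type="comPzAlgType")]
HB.structure Definition ComPzAlgebra (R : comPzRingType) :=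
  {S of GRing.ComPzRing S & PzAlgebra R S}.

(* An R-algebra as an R-module. *)
Definition alg_mod (R : comPzRingType) (S : pzAlgType R) : Type := S.

Section AlgMod.
Variables (R : comPzRingType) (S : pzAlgType R).
Local Notation SR := (alg_mod S).

HB.instance Definition _ := GRing.Zmodule.on SR.

Definition alg_scale (a : R) (x : SR) : SR := alg a * (x : S).

Fact alg_scaleA a b x : alg_scale a (alg_scale b x) = alg_scale (a * b) x.
Proof. by rewrite /alg_scale mulrA rmorphM. Qed.

Fact alg_scale1 : left_id 1 alg_scale.
Proof. by move=> x; rewrite /alg_scale rmorph1 mul1r. Qed.

Fact alg_scaleDr : right_distributive alg_scale +%R.
Proof. by move=> a x y; apply: mulrDr. Qed.

Fact alg_scaleDl x : {morph alg_scale^~ x : a b / a + b}.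
Proof. by move=> a b; rewrite /alg_scale rmorphD mulrDl. Qed.

HB.instance Definition _ := GRing.Zmodule_isLmodule.Build R SR
  alg_scaleA alg_scale1 alg_scaleDr alg_scaleDl.

Definition alg_mul (x y : SR) : SR := (x : S) * (y : S).

Lemma alg_mulDl x x' y : alg_mul (x + x') y = alg_mul x y + alg_mul x' y.
Proof. exact: mulrDl. Qed.

Lemma alg_mulDr x y y' : alg_mul x (y + y') = alg_mul x y + alg_mul x y'.
Proof. exact: mulrDr. Qed.

Lemma alg_mulZl (a : R) x y : alg_mul (a *: x) y = a *: alg_mul x y.
Proof. exact/esym/mulrA. Qed.

Lemma alg_mulZr (a : R) x y : alg_mul x (a *: y) = a *: alg_mul x y.
Proof.
rewrite /alg_mul -[LHS]/((x : S) * (alg a * (y : S))).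
by rewrite mulrA -algC -mulrA.
Qed.

End AlgMod.

(* The additive submonoid generated by A; this is the additive subgroup
   generated by A whenever A is stable under opposite, as in all uses below. *)
Definition addspan (V : zmodType) (A : set V) : set V :=
  [set x | exists l : seq V, (forall y, y \in l -> A y) /\ x = \sum_(y <- l) y].

Section AddSpan.
Variables (V : zmodType) (A : set V).

Lemma addspan0 : addspan A 0.
Proof. by exists [::]; rewrite big_nil. Qed.

Lemma sub_addspan : A `<=` addspan A.
Proof.
by move=> x Ax; exists [:: x]; rewrite big_seq1; split=> // y /[!inE] /eqP ->.
Qed.

Lemma addspanD x y : addspan A x -> addspan A y -> addspan A (x + y).
Proof.
move=> [l [Al ->]] [l' [Al' ->]]; exists (l ++ l'); rewrite big_cat; split=> // z.
by rewrite mem_cat => /orP[/Al|/Al'].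
Qed.

Lemma addspan_min (P : set V) :
    P 0 -> (forall x y, P x -> P y -> P (x + y)) -> A `<=` P ->
  addspan A `<=` P.
Proof.
move=> P0 PD AP _ [l [Al ->]].
elim: l Al => [|x l IHl] Al; first by rewrite big_nil.
rewrite big_cons; apply: PD; first by apply/AP/Al/mem_head.
by apply: IHl => y ly; apply: Al; rewrite in_cons ly orbT.
Qed.

End AddSpan.

Section Ideals.
Variable S : pzRingType.
Implicit Types I J : set S.

(* Two-sided ideals. *)
Definition is_ideal I : Prop :=
  [/\ I 0, forall x y, I x -> I y -> I (x + y)
    & forall a x, I x -> I (a * x) /\ I (x * a)].

Definition ideal_mul I J : set S :=
  addspan [set z | exists x y, [/\ I x, J y & z = x * y]].

Definition idempotent_ideal I : Prop := is_ideal I /\ ideal_mul I I = I.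

Definition maximal_ideal I : Prop :=
  [/\ is_ideal I, I <> setT
    & forall J, is_ideal J -> I `<=` J -> J = I \/ J = setT].

Fixpoint ideal_exp I (n : nat) : set S :=
  if n is n'.+1 then ideal_mul I (ideal_exp I n') else setT.

End Ideals.

Definition local_ring (R : comPzRingType) (m : set R) : Prop :=
  maximal_ideal m /\ forall m' : set R, maximal_ideal m' -> m' = m.

Definition fin_gen (R : pzRingType) (V : lmodType R) (W : set V) : Prop :=
  exists (n : nat) (e : 'I_n -> V),
    W = [set v | exists c : 'I_n -> R, v = \sum_(i < n) c i *: e i].

Definition noetherian (R : comPzRingType) : Prop :=
  forall I : set R, is_ideal I -> fin_gen (I : set R^o).

Definition module_finite (R : comPzRingType) (S : pzAlgType R) : Prop :=
  fin_gen [set: alg_mod S].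

Section IdealPowers.
Variables (R : comPzRingType) (m : set R).

Lemma ideal_expM n a x : ideal_exp m n x -> ideal_exp m n (a * x).
Proof.
elim: n x => [//|n IHn] x.
apply: (@addspan_min _ _ (fun x => ideal_exp m n.+1 (a * x))) x.
- by rewrite mulr0; apply: addspan0.
- by move=> y z ? ?; rewrite mulrDr; apply: addspanD.
- move=> _ [y [z [my mz ->]]]; apply: sub_addspan; exists y, (a * z).
  by rewrite mulrCA; split=> //; apply: IHn.
Qed.

Lemma ideal_exp0 n : ideal_exp m n 0.
Proof. by case: n => [//|n]; apply: addspan0. Qed.

Lemma ideal_expD n x y :
  ideal_exp m n x -> ideal_exp m n y -> ideal_exp m n (x + y).
Proof. by case: n => [//|n]; apply: addspanD. Qed.

Lemma ideal_expN n x : ideal_exp m n x -> ideal_exp m n (- x).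
Proof. by rewrite -mulN1r; apply: ideal_expM. Qed.

Lemma ideal_expB n x y :
  ideal_exp m n x -> ideal_exp m n y -> ideal_exp m n (x - y).
Proof. by move=> mx my; apply: ideal_expD => //; apply: ideal_expN. Qed.

Lemma ideal_expS n : ideal_exp m n.+1 `<=` ideal_exp m n.
Proof.
apply: addspan_min; [exact: ideal_exp0 | exact: ideal_expD|].
by move=> _ [x [y [_ my ->]]]; apply: ideal_expM.
Qed.

End IdealPowers.

(* The m-adic completion, i.e. the inverse limit of the rings R / m ^ n.  A
   compatible family of residue classes is encoded by a sequence of
   representatives u, with u n.+1 congruent to u n modulo m ^ n; two sequences
   are identified when they agree modulo m ^ n for all n. *)
Section Completion.
Variables (R : comPzRingType) (m : set R).
Local Notation mexp := (ideal_exp m).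

Definition compatible (u : nat -> R) : Prop :=
  forall n, mexp n (u n.+1 - u n).

Definition cseq := {u : nat -> R | `[< compatible u >]}.

Lemma cseqP (u : cseq) : compatible (val u).
Proof. exact/asboolP/(valP u). Qed.

Definition Cseq (u : nat -> R) (cu : compatible u) : cseq :=
  exist _ u (introT (asboolP _) cu).

Definition cseq_eq (u v : cseq) : bool :=
  `[< forall n, mexp n (val u n - val v n) >].

Lemma cseq_eq_equiv : equiv_class_of cseq_eq.
Proof.
split=> [u|u v|v u w].
- by apply/asboolP => n; rewrite subrr; apply: ideal_exp0.
- by apply/asboolP/asboolP => e n; rewrite -opprB; apply: ideal_expN.
- move=> /asboolP e /asboolP e'; apply/asboolP => n.
  by rewrite -(subrKA (val v n)); apply: ideal_expD.
Qed.

Canonical cseq_equiv := EquivRelPack cseq_eq_equiv.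
Canonical cseq_encModRel := defaultEncModRel cseq_eq.

Definition completion := {eq_quot cseq_eq}.
HB.instance Definition _ := Choice.on completion.
HB.instance Definition _ : EqQuotient cseq cseq_eq completion :=
  EqQuotient.on completion.

Definition to_completion (u : cseq) : completion := \pi u.

Lemma to_completionP (u v : cseq) :
  to_completion u = to_completion v <-> forall n, mexp n (val u n - val v n).
Proof.
split=> [/eqP|e]; first by rewrite piE => /asboolP.
by apply/eqP; rewrite piE; apply/asboolP.
Qed.

Lemma completion_ind (P : completion -> Prop) :
  (forall u, P (to_completion u)) -> forall x, P x.
Proof. by move=> Pu x; rewrite -[x]reprK; apply: Pu. Qed.

Lemma repr_to_completion (u : cseq) n :
  mexp n (val (repr (to_completion u)) n - val u n).
Proof.
have /to_completionP : to_completion (repr (to_completion u)) = to_completion u.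
  exact: reprK.
exact.
Qed.

Lemma compatible_cst a : compatible (fun=> a).
Proof. by move=> n; rewrite subrr; apply: ideal_exp0. Qed.

Lemma compatibleN u : compatible u -> compatible (fun n => - u n).
Proof. by move=> cu n; rewrite -opprD; apply: ideal_expN. Qed.

Lemma compatibleD u v :
  compatible u -> compatible v -> compatible (fun n => u n + v n).
Proof. by move=> cu cv n; rewrite opprD addrACA; apply: ideal_expD. Qed.

Lemma mexp_mulB n x x' y y' :
  mexp n (x - x') -> mexp n (y - y') -> mexp n (x * y - x' * y').
Proof.
move=> mx my; rewrite -(subrKA (x' * y)) -mulrBl -mulrBr.
by apply: ideal_expD; [rewrite mulrC|]; apply: ideal_expM.
Qed.

Lemma compatibleM u v :
  compatible u -> compatible v -> compatible (fun n => u n * v n).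
Proof. by move=> cu cv n; apply: mexp_mulB. Qed.

Definition cseq_cst a := Cseq (compatible_cst a).
Definition cseq_opp (u : cseq) := Cseq (compatibleN (cseqP u)).
Definition cseq_add (u v : cseq) := Cseq (compatibleD (cseqP u) (cseqP v)).
Definition cseq_mul (u v : cseq) := Cseq (compatibleM (cseqP u) (cseqP v)).

Definition completion_cst (a : R) : completion := to_completion (cseq_cst a).
Definition completion_opp (x : completion) : completion :=
  to_completion (cseq_opp (repr x)).
Definition completion_add (x y : completion) : completion :=
  to_completion (cseq_add (repr x) (repr y)).
Definition completion_mul (x y : completion) : completion :=
  to_completion (cseq_mul (repr x) (repr y)).

Lemma completion_oppE u :
  completion_opp (to_completion u) = to_completion (cseq_opp u).
Proof.
apply/to_completionP => n /=; rewrite -opprD.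
by apply: ideal_expN; apply: repr_to_completion.
Qed.

Lemma completion_addE u v :
  completion_add (to_completion u) (to_completion v) =
  to_completion (cseq_add u v).
Proof.
apply/to_completionP => n /=; rewrite opprD addrACA.
by apply: ideal_expD; apply: repr_to_completion.
Qed.

Lemma completion_mulE u v :
  completion_mul (to_completion u) (to_completion v) =
  to_completion (cseq_mul u v).
Proof.
by apply/to_completionP => n /=; apply: mexp_mulB; apply: repr_to_completion.
Qed.

Let cE := (completion_oppE, completion_addE, completion_mulE).

Lemma to_completion_eq (u v : cseq) :
  val u =1 val v -> to_completion u = to_completion v.
Proof.
move=> e; apply/to_completionP => n; rewrite e subrr; exact: ideal_exp0.
Qed.

Fact completion_addA : associative completion_add.
Proof.
elim/completion_ind=> u; elim/completion_ind=> v; elim/completion_ind=> w.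
by rewrite !cE; apply: to_completion_eq => n /=; rewrite addrA.
Qed.

Fact completion_addC : commutative completion_add.
Proof.
elim/completion_ind=> u; elim/completion_ind=> v.
by rewrite !cE; apply: to_completion_eq => n /=; rewrite addrC.
Qed.

Fact completion_add0 : left_id (completion_cst 0) completion_add.
Proof.
elim/completion_ind=> u.
by rewrite !cE; apply: to_completion_eq => n /=; rewrite add0r.
Qed.

Fact completion_addN :
  left_inverse (completion_cst 0) completion_opp completion_add.
Proof.
elim/completion_ind=> u.
by rewrite !cE; apply: to_completion_eq => n /=; rewrite addNr.
Qed.

HB.instance Definition _ := GRing.isZmodule.Build completion
  completion_addA completion_addC completion_add0 completion_addN.

Fact completion_mulA : associative completion_mul.
Proof.
elim/completion_ind=> u; elim/completion_ind=> v; elim/completion_ind=> w.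
by rewrite !cE; apply: to_completion_eq => n /=; rewrite mulrA.
Qed.

Fact completion_mulC : commutative completion_mul.
Proof.
elim/completion_ind=> u; elim/completion_ind=> v.
by rewrite !cE; apply: to_completion_eq => n /=; rewrite mulrC.
Qed.

Fact completion_mul1 : left_id (completion_cst 1) completion_mul.
Proof.
elim/completion_ind=> u.
by rewrite !cE; apply: to_completion_eq => n /=; rewrite mul1r.
Qed.

Fact completion_mulDl : left_distributive completion_mul +%R.
Proof.
elim/completion_ind=> u; elim/completion_ind=> v; elim/completion_ind=> w.
rewrite -[RHS]/(completion_add _ _) -[X in completion_mul X]/(completion_add _ _).
rewrite !cE.
by apply: to_completion_eq => n /=; rewrite mulrDl.
Qed.

HB.instance Definition _ := GRing.Zmodule_isComPzRing.Build completion
  completion_mulA completion_mulC completion_mul1 completion_mulDl.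

Lemma completion_cstD : {morph completion_cst : a b / a + b}.
Proof.
move=> a b; rewrite -[RHS]/(completion_add _ _) cE.
exact: to_completion_eq.
Qed.

Lemma completion_cstM : {morph completion_cst : a b / a * b}.
Proof.
move=> a b; rewrite -[RHS]/(completion_mul _ _) cE.
exact: to_completion_eq.
Qed.

Fact completion_cst_is_zmod_morphism : zmod_morphism completion_cst.
Proof.
move=> a b; apply: (addIr (completion_cst b)).
by rewrite -completion_cstD !subrK.
Qed.

HB.instance Definition _ := GRing.isZmodMorphism.Build R completion
  completion_cst completion_cst_is_zmod_morphism.

Fact completion_cst_is_monoid_morphism : monoid_morphism completion_cst.
Proof. by split=> //; apply: completion_cstM. Qed.

HB.instance Definition _ := GRing.isMonoidMorphism.Build R completion
  completion_cst completion_cst_is_monoid_morphism.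

HB.instance Definition _ := isPzAlgebra.Build R completion
  (alg := completion_cst) (fun a x => mulrC (completion_cst a) x).

End Completion.

(* Tensor products over a commutative ring: formal finite sums of pairs modulo
   the congruence generated by biadditivity and balancedness.  Opposites need
   not be adjoined: (- x, y) is opposite to (x, y) in the quotient. *)
Section Tensor.
Variables (R : comPzRingType) (M N : lmodType R).

Inductive tens_eq : seq (M * N) -> seq (M * N) -> Prop :=
| tens_eq_refl l : tens_eq l l
| tens_eq_sym l l' : tens_eq l l' -> tens_eq l' l
| tens_eq_trans l l' l'' : tens_eq l l' -> tens_eq l' l'' -> tens_eq l l''
| tens_eq_cat l1 l1' l2 l2' :
    tens_eq l1 l1' -> tens_eq l2 l2' -> tens_eq (l1 ++ l2) (l1' ++ l2')
| tens_eq_catC l l' : tens_eq (l ++ l') (l' ++ l)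
| tens_eq_0 y : tens_eq [:: (0, y)] [::]
| tens_eq_Dl x x' y : tens_eq [:: (x + x', y)] [:: (x, y); (x', y)]
| tens_eq_Dr x y y' : tens_eq [:: (x, y + y')] [:: (x, y); (x, y')]
| tens_eq_Z a x y : tens_eq [:: (a *: x, y)] [:: (x, a *: y)].

Definition tens_eqb (l l' : seq (M * N)) : bool := `[< tens_eq l l' >].

Lemma tens_eqb_equiv : equiv_class_of tens_eqb.
Proof.
split=> [l|l l'|l' l l''].
- by apply/asboolP; apply: tens_eq_refl.
- by apply/asboolP/asboolP; apply: tens_eq_sym.
- by move=> /asboolP e /asboolP e'; apply/asboolP; apply: tens_eq_trans e'.
Qed.

Canonical tens_equiv := EquivRelPack tens_eqb_equiv.
Canonical tens_encModRel := defaultEncModRel tens_eqb.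

Definition tensor := {eq_quot tens_eqb}.
HB.instance Definition _ := Choice.on tensor.
HB.instance Definition _ : EqQuotient (seq (M * N)) tens_eqb tensor :=
  EqQuotient.on tensor.

Definition to_tensor (l : seq (M * N)) : tensor := \pi l.

Lemma to_tensorP l l' : to_tensor l = to_tensor l' <-> tens_eq l l'.
Proof.
split=> [/eqP|e]; first by rewrite piE => /asboolP.
by apply/eqP; rewrite piE; apply/asboolP.
Qed.

Lemma to_tensorW (P : tensor -> Prop) :
  (forall l, P (to_tensor l)) -> forall x, P x.
Proof. by move=> Pl x; rewrite -[x]reprK; apply: Pl. Qed.

Lemma repr_to_tensor l : tens_eq (repr (to_tensor l)) l.
Proof. by apply/to_tensorP; apply: reprK. Qed.

Definition tens_oppl (l : seq (M * N)) := [seq (- p.1, p.2) | p <- l].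

Definition tens_opp (t : tensor) : tensor := to_tensor (tens_oppl (repr t)).
Definition tens_add (t t' : tensor) : tensor := to_tensor (repr t ++ repr t').

Lemma tens_addE l l' :
  tens_add (to_tensor l) (to_tensor l') = to_tensor (l ++ l').
Proof. by apply/to_tensorP/tens_eq_cat; apply: repr_to_tensor. Qed.

Fact tens_addA : associative tens_add.
Proof.
elim/to_tensorW=> l; elim/to_tensorW=> l'; elim/to_tensorW=> l''.
by rewrite !tens_addE catA.
Qed.

Fact tens_addC : commutative tens_add.
Proof.
elim/to_tensorW=> l; elim/to_tensorW=> l'.
by rewrite !tens_addE; apply/to_tensorP/tens_eq_catC.
Qed.

Fact tens_add0 : left_id (to_tensor [::]) tens_add.
Proof. by elim/to_tensorW=> l; rewrite tens_addE. Qed.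

Fact tens_addN : left_inverse (to_tensor [::]) tens_opp tens_add.
Proof.
move=> t; rewrite -{2}[t]reprK tens_addE; apply/to_tensorP.
elim: (repr t) => [|[x y] l IHl] /=; first exact: tens_eq_refl.
rewrite -cat1s -[(x, y) :: l]cat1s catA.
apply: (@tens_eq_trans _ ([:: (- x, y)] ++ ([:: (x, y)] ++ tens_oppl l ++ l))).
  rewrite -!catA; apply: tens_eq_cat; first exact: tens_eq_refl.
  by rewrite !catA; apply: tens_eq_cat (tens_eq_refl _); apply: tens_eq_catC.
rewrite catA -[X in tens_eq _ X]cat0s; apply: tens_eq_cat IHl.
apply: tens_eq_trans (tens_eq_0 y); apply: tens_eq_sym.
by rewrite -(addNr x); apply: tens_eq_Dl.
Qed.

HB.instance Definition _ := GRing.isZmodule.Build tensor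
  tens_addA tens_addC tens_add0 tens_addN.

Definition tens (x : M) (y : N) : tensor := to_tensor [:: (x, y)].

Lemma to_tensorE l : to_tensor l = \sum_(p <- l) tens p.1 p.2.
Proof.
elim: l => [|[x y] l IHl]; first by rewrite big_nil.
by rewrite big_cons -IHl -[RHS]/(tens_add _ _) tens_addE.
Qed.

Lemma tensDl x x' y : tens (x + x') y = tens x y + tens x' y.
Proof.
by rewrite -[RHS]/(tens_add _ _) tens_addE; apply/to_tensorP/tens_eq_Dl.
Qed.

Lemma tensDr x y y' : tens x (y + y') = tens x y + tens x y'.
Proof.
by rewrite -[RHS]/(tens_add _ _) tens_addE; apply/to_tensorP/tens_eq_Dr.
Qed.

Lemma tensZ a x y : tens (a *: x) y = tens x (a *: y).
Proof. exact/to_tensorP/tens_eq_Z. Qed.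

Lemma tensor_ind (P : tensor -> Prop) :
    P 0 -> (forall x y, P (tens x y)) ->
    (forall t t', P t -> P t' -> P (t + t')) ->
  forall t, P t.
Proof.
move=> P0 Pxy PD; elim/to_tensorW=> l; rewrite to_tensorE.
elim: l => [|p l IHl]; first by rewrite big_nil.
by rewrite big_cons; apply: PD.
Qed.

Record balanced (A : zmodType) (f : M -> N -> A) : Prop := {
  balancedDl : forall x x' y, f (x + x') y = f x y + f x' y;
  balancedDr : forall x y y', f x (y + y') = f x y + f x y';
  balancedZ : forall a x y, f (a *: x) y = f x (a *: y)
}.

Definition tlift (A : zmodType) (f : M -> N -> A) (t : tensor) : A :=
  \sum_(p <- repr t) f p.1 p.2.

Section Lift.
Variables (A : zmodType) (f : M -> N -> A).
Hypothesis bf : balanced f.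

Lemma tens_eq_balanced l l' :
  tens_eq l l' -> \sum_(p <- l) f p.1 p.2 = \sum_(p <- l') f p.1 p.2.
Proof.
have [fDl fDr fZ] := bf.
elim=> {l l'} [//|//|l l' l'' _ -> _ //|||y|x x' y|x y y'|a x y].
- by move=> l1 l1' l2 l2' _ e1 _ e2; rewrite !big_cat e1 e2.
- by move=> l l'; rewrite !big_cat /= addrC.
- by rewrite big_seq1 big_nil; apply: (addIr (f 0 y)); rewrite -fDl !add0r.
- by rewrite !big_cons !big_nil !addr0 fDl.
- by rewrite !big_cons !big_nil !addr0 fDr.
- by rewrite !big_seq1 fZ.
Qed.

Lemma tlift_to_tensor l : tlift f (to_tensor l) = \sum_(p <- l) f p.1 p.2.
Proof. exact/tens_eq_balanced/repr_to_tensor. Qed.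

Lemma tlift_tens x y : tlift f (tens x y) = f x y.
Proof. by rewrite tlift_to_tensor big_seq1. Qed.

Lemma tlift0 : tlift f 0 = 0.
Proof. by rewrite -[0 in LHS]/(to_tensor [::]) tlift_to_tensor big_nil. Qed.

Lemma tliftD : {morph tlift f : t t' / t + t'}.
Proof.
elim/to_tensorW=> l; elim/to_tensorW=> l'.
rewrite -[to_tensor l + to_tensor l']/(tens_add _ _) tens_addE.
by rewrite !tlift_to_tensor big_cat.
Qed.

End Lift.

End Tensor.

(* The biadditive map (x (x) b, s (x) c) |-> op x s (x) (alg_mul b c) induced by an
   R-bilinear map op. *)
Section TensorAction.
Variables (R : comPzRingType) (B : comPzAlgType R) (M S : lmodType R).
Variable op : M -> S -> M.
Hypothesis opDl : forall x x' s, op (x + x') s = op x s + op x' s.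
Hypothesis opDr : forall x s s', op x (s + s') = op x s + op x s'.
Hypothesis opZl : forall a x s, op (a *: x) s = a *: op x s.
Hypothesis opZr : forall a x s, op x (a *: s) = a *: op x s.

Definition tact (t : tensor M (alg_mod B)) (u : tensor S (alg_mod B)) : tensor M (alg_mod B) :=
  tlift (fun x b => tlift (fun s c => tens (op x s) (alg_mul b c)) u) t.

Lemma tact_balanced_in x b :
  balanced (fun (s : S) (c : alg_mod B) => tens (op x s) (alg_mul b c)).
Proof.
split=> [s s' c|s c c'|a s c]; first by rewrite opDr tensDl.
  by rewrite alg_mulDr tensDr.
by rewrite opZr tensZ alg_mulZr.
Qed.
Local Notation bi := (tact_balanced_in _ _).

Lemma tact_balanced_out u :
  balanced (fun (x : M) (b : alg_mod B) =>
    tlift (fun (s : S) (c : alg_mod B) => tens (op x s) (alg_mul b c)) u).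
Proof.
split=> [x x' b|x b b'|a x b]; elim/tensor_ind: u => [|s c|t t' IH IH'];
  rewrite ?(tlift0 bi) ?(tlift_tens bi) ?(tliftD bi) ?addr0 //.
- by rewrite opDl tensDl.
- by rewrite IH IH' addrACA.
- by rewrite alg_mulDl tensDr.
- by rewrite IH IH' addrACA.
- by rewrite opZl tensZ alg_mulZl.
- by rewrite IH IH'.
Qed.
Local Notation bo := (tact_balanced_out _).

Lemma tact_tens x b s c :
  tact (tens x b) (tens s c) = tens (op x s) (alg_mul b c).
Proof. by rewrite /tact (tlift_tens bo) (tlift_tens bi). Qed.

Lemma tact0l u : tact 0 u = 0.
Proof. exact: (tlift0 bo). Qed.

Lemma tactDl t t' u : tact (t + t') u = tact t u + tact t' u.
Proof. exact: (tliftD bo). Qed.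

Lemma tactDr t u u' : tact t (u + u') = tact t u + tact t u'.
Proof.
elim/tensor_ind: t => [|x b|t t' IH IH']; first by rewrite !tact0l addr0.
  by rewrite /tact !(tlift_tens bo) (tliftD bi).
by rewrite !tactDl IH IH' addrACA.
Qed.

Lemma tact0r t : tact t 0 = 0.
Proof. by apply: (addIr (tact t 0)); rewrite -tactDr !add0r. Qed.

End TensorAction.

(* The R-algebra S (x)_R B, with (s (x) b) * (t (x) c) = st (x) bc. *)
Definition alg_tensor (R : comPzRingType) (S : pzAlgType R)
  (B : comPzAlgType R) : Type := tensor (alg_mod S) (alg_mod B).

Section TensorRing.
Variables (R : comPzRingType) (S : pzAlgType R) (B : comPzAlgType R).
Local Notation SB := (alg_tensor S B).

HB.instance Definition _ := GRing.Zmodule.on SB.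

Definition atens (s : S) (b : B) : SB := tens (s : alg_mod S) (b : alg_mod B).

Lemma alg_tensor_ind (P : SB -> Prop) :
    P 0 -> (forall s b, P (atens s b)) ->
    (forall t t', P t -> P t' -> P (t + t')) ->
  forall t, P t.
Proof. exact: (@tensor_ind R (alg_mod S) (alg_mod B) P). Qed.

Definition tens_mul : SB -> SB -> SB := tact (@alg_mul R S).

Let Dl := @alg_mulDl R S.
Let Dr := @alg_mulDr R S.
Let Zl := @alg_mulZl R S.
Let Zr := @alg_mulZr R S.

Lemma tens_mul_tens s b t c :
  tens_mul (atens s b) (atens t c) = atens (s * t) (b * c).
Proof. exact: (tact_tens Dl Dr Zl Zr). Qed.

Fact tens_mulDl : left_distributive tens_mul +%R.
Proof. by move=> x y z; apply: (tactDl Dl Dr Zl Zr). Qed.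

Fact tens_mulDr : right_distributive tens_mul +%R.
Proof. by move=> x y z; apply: (tactDr Dl Dr Zl Zr). Qed.

Let mul0 t : tens_mul 0 t = 0.
Proof. exact: (tact0l Dl Dr Zl Zr). Qed.

Let mulx0 t : tens_mul t 0 = 0.
Proof. exact: (tact0r Dl Dr Zl Zr). Qed.

Fact tens_mulA : associative tens_mul.
Proof.
elim/alg_tensor_ind=> [|s b|x x' IHx IHx'] y z; first by rewrite !mul0.
  elim/alg_tensor_ind: y => [|s' b'|y y' IHy IHy'].
  - by rewrite mulx0 !mul0 mulx0.
  - elim/alg_tensor_ind: z => [|s'' b''|z z' IHz IHz']; first by rewrite !mulx0.
      by rewrite !tens_mul_tens !mulrA.
    by rewrite !tens_mulDr IHz IHz'.
  - by rewrite tens_mulDl !tens_mulDr tens_mulDl IHy IHy'.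
by rewrite !tens_mulDl IHx IHx'.
Qed.

Fact tens_mul1 : left_id (atens 1 1) tens_mul.
Proof.
elim/alg_tensor_ind=> [|s b|x x' IHx IHx']; first by rewrite mulx0.
  by rewrite tens_mul_tens !mul1r.
by rewrite tens_mulDr IHx IHx'.
Qed.

Fact tens_mulr1 : right_id (atens 1 1) tens_mul.
Proof.
elim/alg_tensor_ind=> [|s b|x x' IHx IHx']; first by rewrite mul0.
  by rewrite tens_mul_tens !mulr1.
by rewrite tens_mulDl IHx IHx'.
Qed.

HB.instance Definition _ := GRing.Zmodule_isPzRing.Build SB
  tens_mulA tens_mul1 tens_mulr1 tens_mulDl tens_mulDr.

Lemma mul_atens s t b c : atens s b * atens t c = atens (s * t) (b * c).
Proof. exact: tens_mul_tens. Qed.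

End TensorRing.

(* Right modules over S are left modules over the converse ring S^c: the
   product x . s is s *: x.  A right module over an R-algebra S is an R-module
   through R -> S. *)
Definition restrict (R : comPzRingType) (S : pzAlgType R)
  (N : lmodType S^c) : Type := N.

Section Restrict.
Variables (R : comPzRingType) (S : pzAlgType R) (N : lmodType S^c).
Local Notation NR := (restrict N).

HB.instance Definition _ := GRing.Zmodule.on NR.

Definition restrict_scale (a : R) (x : NR) : NR :=
  ((alg a : S) : S^c) *: (x : N).

Fact restrict_scaleA a b x :
  restrict_scale a (restrict_scale b x) = restrict_scale (a * b) x.
Proof.
rewrite /restrict_scale scalerA; congr (_ *: _).
by rewrite -[LHS]/((alg b : S) * (alg a : S)) rmorphM algC.
Qed.

Fact restrict_scale1 : left_id 1 restrict_scale.
Proof. by move=> x; rewrite /restrict_scale rmorph1 scale1r. Qed.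

Fact restrict_scaleDr : right_distributive restrict_scale +%R.
Proof. by move=> a x y; apply: scalerDr. Qed.

Fact restrict_scaleDl x : {morph restrict_scale^~ x : a b / a + b}.
Proof.
by move=> a b; rewrite /restrict_scale -scalerDl rmorphD.
Qed.

HB.instance Definition _ := GRing.Zmodule_isLmodule.Build R NR
  restrict_scaleA restrict_scale1 restrict_scaleDr restrict_scaleDl.

End Restrict.

(* N (x)_R B as a right (S (x)_R B)-module: (x (x) b) . (s (x) c) = xs (x) bc. *)
Definition extend_module (R : comPzRingType) (S : pzAlgType R)
  (B : comPzAlgType R) (N : lmodType S^c) : Type := tensor (restrict N) (alg_mod B).

Section ExtendModule.
Variables (R : comPzRingType) (S : pzAlgType R) (B : comPzAlgType R).
Variable N : lmodType S^c.
Local Notation SB := (alg_tensor S B).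
Local Notation NB := (extend_module B N).

HB.instance Definition _ := GRing.Zmodule.on NB.

Definition ract (x : restrict N) (s : alg_mod S) : restrict N :=
  ((s : S) : S^c) *: (x : N).

Let rDl (x x' : restrict N) s : ract (x + x') s = ract x s + ract x' s.
Proof. exact: (@scalerDr S^c N). Qed.
Let rDr (x : restrict N) s s' : ract x (s + s') = ract x s + ract x s'.
Proof. exact: (@scalerDl S^c N). Qed.
Let rA (x : restrict N) (s t : S) : ract (ract x s) t = ract x (s * t).
Proof. exact: (@scalerA S^c N). Qed.
Let rZ (a : R) (x : restrict N) : a *: x = ract x (alg a).
Proof. by []. Qed.
Let rZl (a : R) (x : restrict N) s : ract (a *: x) s = a *: ract x s.
Proof. by rewrite !rZ !rA algC. Qed.
Let rZr (a : R) (x : restrict N) (s : alg_mod S) :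
  ract x (a *: s) = a *: ract x s.
Proof. by rewrite rZ rA -algC. Qed.

Definition mtens (x : N) (b : B) : NB :=
  tens (x : restrict N) (b : alg_mod B).

Lemma extend_module_ind (P : NB -> Prop) :
    P 0 -> (forall x b, P (mtens x b)) ->
    (forall t t', P t -> P t' -> P (t + t')) ->
  forall t, P t.
Proof. exact: (@tensor_ind R (restrict N) (alg_mod B) P). Qed.

Definition extend_scale (u : SB^c) (t : NB) : NB :=
  tact ract (t : tensor (restrict N) (alg_mod B))
    (u : tensor (alg_mod S) (alg_mod B)).

Lemma extend_scale_tens (x : N) (b : B) (s : S) (c : B) :
  extend_scale (atens s c) (mtens x b) = mtens ((s : S^c) *: x) (b * c).
Proof. exact: (tact_tens rDl rDr rZl rZr). Qed.

Fact extend_scaleDr : right_distributive extend_scale +%R.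
Proof. by move=> u t t'; apply: (tactDl rDl rDr rZl rZr). Qed.

Fact extend_scaleDl t : {morph extend_scale^~ t : u v / u + v}.
Proof. by move=> u v; apply: (tactDr rDl rDr rZl rZr). Qed.

Let scale0 u : extend_scale u 0 = 0.
Proof. exact: (tact0l rDl rDr rZl rZr). Qed.

Let scalex0 t : extend_scale 0 t = 0.
Proof. exact: (tact0r rDl rDr rZl rZr). Qed.

Fact extend_scale1 : left_id 1 extend_scale.
Proof.
elim/extend_module_ind=> [|x b|t t' IH IH']; first exact: scale0.
  by rewrite extend_scale_tens scale1r mulr1.
by rewrite extend_scaleDr IH IH'.
Qed.

Fact extend_scaleA (u v : SB^c) t :
  extend_scale u (extend_scale v t) = extend_scale (u * v) t.
Proof.
rewrite -[u * v]/((v : SB) * (u : SB)).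
elim/extend_module_ind: t => [|x b|t t' IH IH']; first by rewrite !scale0.
  elim/(@alg_tensor_ind R S B): v => [|s c|v v' IH IH'].
  - by rewrite scalex0 scale0 mul0r scalex0.
  - elim/(@alg_tensor_ind R S B): u => [|s' c'|u u' IH IH'].
    + by rewrite scalex0 mulr0 scalex0.
    + by rewrite mul_atens !extend_scale_tens scalerA mulrA.
    + by rewrite extend_scaleDl IH IH' mulrDr extend_scaleDl.
  - by rewrite extend_scaleDl extend_scaleDr IH IH' mulrDl extend_scaleDl.
by rewrite !extend_scaleDr IH IH'.
Qed.

HB.instance Definition _ := GRing.Zmodule_isLmodule.Build SB^c NB
  extend_scaleA extend_scale1 extend_scaleDr extend_scaleDl.

End ExtendModule.

(* K, as a submodule of the right regular T-module, is isomorphic to M. *)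
Definition ideal_iso (T : pzRingType) (K : set T) (M : lmodType T^c) : Prop :=
  exists f : {linear M -> (T^c)^o},
    injective f /\ forall y : T, K y <-> exists x : M, f x = y.

(* The image of J (x)_R B in S (x)_R B. *)
Definition extend_ideal (R : comPzRingType) (S : pzAlgType R)
    (B : comPzAlgType R) (J : set S) : set (alg_tensor S B) :=
  addspan [set t | exists (s : S) (b : B), J s /\ t = atens s b].
Arguments extend_ideal {R S} B J.

Definition trace_ideal (S : pzRingType) (N : lmodType S^c) : set S :=
  addspan [set s : S | exists (f : {linear N -> (S^c)^o}) (x : N), f x = s].

(* Main.v *)
Require Import Defs.
From HB Require Import structures.
From mathcomp Require Import all_boot all_algebra.
From mathcomp Require Import boolp classical_sets.

(** Write B for the completion of R and T for the ring S (x) B.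

    Everything rests on two consequences of noetherianity.  Contraction
    ([tensor_contraction]): for any R-module N and submodule P, an element x
    of N with x (x) 1 in the span of P (x) B lies in P, because an equality in
    N (x) B involves only finitely many elements of N and so reduces to the
    Krull intersection theorem in a finitely generated submodule.  Flatness
    ([completion_flat]), in its equational form: a linear relation over B
    between elements of a finitely generated R-module is a combination over B
    of relations over R.  Both come from Krull's maximality argument
    ([artin_rees_step]) and its consequence, a weak Artin-Rees lemma
    ([artin_rees]): the m-adic topology of a submodule is the induced one.

    If J is an ideal of S, flatness makes J (x) B -> T injective with image
    J B, so an idempotent J with J B = K shows that K is extended from the right
    module J ([ideal_iso_extend_ideal]).

    Conversely let f : N (x) B -> K be an isomorphism of right T-modules.  An
    idempotent ideal K of T is finitely generated over B, for a direct reason: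
    K has a finite subset F spanning it modulo m T, because T / m T = S / m S,
    and then K = K K lies in F T + m T K = F T + m K; a successive approximation
    in the complete module T gives K = F T ([idempotent_ideal_fin_gen]).  Hence
    finitely many elements of N generate N (x) B, and by contraction they
    generate N ([extended_fin_gen]).

    As N is finitely presented, flatness shows that the S-linear map
    x |-> f (x (x) 1) from N to T is a sum of maps x |-> g x (x) y with
    g : N -> S linear and y in B ([hom_tensor_presentation]); therefore
    K is contained in Tr(N) B.  The reverse inclusion uses K = K K once more:
    for g : N -> S, the map (g (x) B) f^-1 from K to T sends K K into
    T K, hence into K ([extend_trace_sub_ideal]).  So Tr(N) B = K.  Finally
    contraction makes J |-> J B injective on ideals and reflect inclusions
    ([extend_ideal_sub]): from Tr(N)^2 B = K^2 = K = Tr(N) B it follows that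
    Tr(N) is idempotent, and Tr(N) is the only ideal that extends to K. *)

Set Implicit Arguments.
Unset Strict Implicit.
Unset Printing Implicit Defensive.

Import GRing.Theory.
Local Open Scope classical_set_scope.
Local Open Scope ring_scope.

(** * Submodules and the noetherian property *)

Section Submodules.
Variables (R : comPzRingType) (V : lmodType R).
Implicit Types (W P : set V) (l : seq V).

Definition is_submod W : Prop :=
  [/\ W 0, forall x y, W x -> W y -> W (x + y)
    & forall a x, W x -> W (a *: x)].

Lemma submodN W x : is_submod W -> W x -> W (- x).
Proof. by move=> [_ _ WZ] Wx; rewrite -scaleN1r; apply: WZ. Qed.

Lemma submodB W x y : is_submod W -> W x -> W y -> W (x - y).
Proof. by move=> sW Wx Wy; case: (sW) => _ WD _; apply: WD => //; apply: submodN. Qed.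

Lemma submod_sum W (I : Type) (r : seq I) (P : pred I) (F : I -> V) :
  is_submod W -> (forall i, P i -> W (F i)) -> W (\sum_(i <- r | P i) F i).
Proof. by move=> [W0 WD _] WF; apply: big_ind. Qed.

Lemma submodI W P : is_submod W -> is_submod P -> is_submod (W `&` P).
Proof.
move=> [W0 WD WZ] [P0 PD PZ]; split=> // [x y [Wx Px] [Wy Py]|a x [Wx Px]].
  by split; [apply: WD|apply: PD].
by split; [apply: WZ|apply: PZ].
Qed.

(** The recursion peels off one coefficient at a time, which is the form in
    which induction on the generators uses membership. *)
Fixpoint lspan l : set V :=
  if l is x :: l' then [set v | exists a, lspan l' (v - a *: x)] else [set 0].

Lemma submod_lspan l : is_submod (lspan l).
Proof.
elim: l => [|x l [L0 LD LZ]] /=.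
  split=> [//|_ _ -> ->|a _ ->]; [exact: addr0|exact: scaler0].
split=> [|v w [a va] [b wb]|b v [a va]].
- by exists 0; rewrite scale0r subr0.
- by exists (a + b); rewrite scalerDl opprD addrACA; apply: LD.
- by exists (b * a); rewrite -scalerA -scalerBr; apply: LZ.
Qed.

Lemma lspan_mem l x : x \in l -> lspan l x.
Proof.
elim: l => // y l IHl /[!inE] /orP[/eqP->|/IHl lx] /=.
  by exists 1; rewrite scale1r subrr; case: (submod_lspan l).
by exists 0; rewrite scale0r subr0.
Qed.

Lemma lspan_sub W l :
  is_submod W -> (forall x, x \in l -> W x) -> lspan l `<=` W.
Proof.
move=> sW; case: (sW) => W0 WD WZ; elim: l => [_ _ -> //|x l IHl] Wl v /= [a va].
rewrite -(subrK (a *: x) v); apply: WD; last by apply/WZ/Wl/mem_head.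
by apply: IHl va => y ly; apply: Wl; rewrite inE ly orbT.
Qed.

Lemma lspanP l v :
  lspan l v <-> exists c : nat -> R, v = \sum_(i < size l) c i *: l`_i.
Proof.
split; last first.
  case=> c ->; apply: submod_sum (submod_lspan l) _ => i _.
  by case: (submod_lspan l) => _ _; apply; apply/lspan_mem/mem_nth.
elim: l v => [_ -> |x l IHl v [a /IHl [c /eqP]]] /=.
  by exists (fun=> 0); rewrite big_ord0.
rewrite subr_eq => /eqP ->; exists (fun i => if i is j.+1 then c j else a).
by rewrite big_ord_recl /= addrC.
Qed.

Lemma fin_gen_lspan W : fin_gen W -> exists l, W = lspan l.
Proof.
move=> [n [e ->]]; exists [seq e i | i <- enum 'I_n].
apply/seteqP; split=> [_ [c ->]|].
  apply: submod_sum (submod_lspan _) _ => i _.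
  case: (submod_lspan [seq e i | i <- enum 'I_n]) => _ _; apply.
  by apply/lspan_mem/map_f; rewrite mem_enum.
apply: lspan_sub => [|_ /mapP[i _ ->]].
  split=> [|_ _ [c ->] [d ->]|a _ [c ->]].
  - by exists (fun=> 0); rewrite big1 // => i _; rewrite scale0r.
  - exists (fun i => c i + d i); rewrite -big_split /=.
    by apply: eq_bigr => i _; rewrite scalerDl.
  - exists (fun i => a * c i); rewrite scaler_sumr.
    by apply: eq_bigr => i _; rewrite scalerA.
exists (fun j => (j == i)%:R); rewrite (bigD1 i) //= eqxx scale1r big1 ?addr0 //.
by move=> j /negPf ->; rewrite scale0r.
Qed.

End Submodules.

Lemma lspan_regular (R : comPzRingType) : lspan [:: 1 : R^o] = setT.
Proof.
apply/seteqP; split=> // a _ /=; exists a; rewrite -[X in _ - X]/(a * 1).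
by rewrite mulr1 subrr.
Qed.

Lemma ideal_submod (R : comPzRingType) (I : set R) :
  is_ideal I <-> is_submod (I : set R^o).
Proof.
split=> [[I0 ID IM]|[I0 ID IZ]]; split=> // a x Ix; first by case: (IM a x Ix).
by split; [|rewrite mulrC]; apply: IZ.
Qed.

Section Noetherian.
Variables (R : comPzRingType) (R_noeth : noetherian R).

(** Induction on the generators: modulo the span of l, P is governed by the ideal
    of coefficients at x, which is finitely generated; lifts of its generators
    to P, with generators of P inside the span of l, generate P. *)
Lemma noetherian_submod (V : lmodType R) (l : seq V) (P : set V) :
  is_submod P -> P `<=` lspan l -> exists l', P = lspan l'.
Proof.
elim: l P => [|x l IHl] P sP Pl.
  exists [::]; apply/seteqP; split=> [v /Pl//|_ -> ]; by case: sP.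
have [sl0 slD slZ] := submod_lspan l; have [P0 PD PZ] := sP.
pose I : set R := [set a | exists p, P p /\ lspan l (p - a *: x)].
have /fin_gen_lspan[s Is] : fin_gen (I : set R^o).
  apply/R_noeth/ideal_submod; split.
  - by exists 0; rewrite scale0r subrr.
  - move=> a b [p [Pp pa]] [q [Pq qb]]; exists (p + q); split; first exact: PD.
    by rewrite scalerDl opprD addrACA; apply: slD.
  - move=> b a [p [Pp pa]]; exists (b *: p); split; first exact: PZ.
    by rewrite -[b *: a]/(b * a) -scalerA -scalerBr; apply: slZ.
have [l1 P'l1] : exists l1, P `&` lspan l = lspan l1.
  apply: IHl; [exact/submodI/submod_lspan|by move=> v []].
have /choice[p pP] : forall a, exists p, I a -> P p /\ lspan l (p - a *: x).
  by move=> a; have [[q ?]|NIa] := EM (I a); [exists q|exists 0].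
exists (map p s ++ l1); apply/seteqP; split=> [v Pv|]; last first.
  apply: lspan_sub => // v; rewrite mem_cat => /orP[/mapP[a sa ->]|/lspan_mem].
    by case: (pP a) => //; rewrite Is; apply: lspan_mem.
  by rewrite -P'l1 => -[].
have /= [a va] := Pl v Pv.
set L := lspan _; have sL : is_submod L := submod_lspan _.
have [L0 LD LZ] := sL.
have : lspan s a by rewrite -Is; exists v.
move=> /lspanP[c ac].
rewrite -(subrK (\sum_(i < size s) c i *: p s`_i) v).
have Psi (i : 'I_(size s)) : P (p s`_i) /\ lspan l (p s`_i - s`_i *: x).
  by apply: pP; rewrite Is; apply/lspan_mem/mem_nth.
apply: LD; last first.
  apply: submod_sum => // i _; apply/LZ/lspan_mem; rewrite mem_cat.
  by apply/orP; left; apply/map_f/mem_nth.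
have: lspan l1 (v - \sum_(i < size s) c i *: p s`_i).
  rewrite -P'l1; split.
    apply: submodB => //; apply: submod_sum => // i _.
    by apply: PZ; case: (Psi i).
  rewrite -(subrKA (a *: x)); apply: slD => //.
  rewrite ac scaler_suml -sumrB; apply: submod_sum => [|i _].
    exact: submod_lspan.
  rewrite -scalerA -scalerBr -opprB; apply: slZ; apply: submodN; last first.
    by case: (Psi i).
  exact: submod_lspan.
by apply: lspan_sub => // w wl1; apply: lspan_mem; rewrite mem_cat wl1 orbT.
Qed.

Lemma noetherian_stable (V : lmodType R) (l : seq V) (F : nat -> set V) :
    (forall n, is_submod (F n)) -> (forall n, F n `<=` F n.+1) ->
    (forall n, F n `<=` lspan l) ->
  exists s, forall n, F n `<=` F s.
Proof.
move=> sF F1 Fl.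
have Fle m n : (m <= n)%N -> F m `<=` F n.
  move=> /subnK <-; elim: (n - m)%N => [//|k IHk] x /IHk; exact: F1.
have [l' U] : exists l', [set v | exists n, F n v] = lspan l'.
  apply: (@noetherian_submod _ l); last by move=> v [n /Fl].
  split=> [|x y [n Fx] [k Fy]|a x [n Fx]].
  - by exists 0%N; case: (sF 0%N).
  - exists (maxn n k); case: (sF (maxn n k)) => _ D _.
    by apply: D; [apply: Fle Fx; apply: leq_maxl|apply: Fle Fy; apply: leq_maxr].
  - by exists n; case: (sF n) => _ _; apply.
have [s Fs] : exists s, forall x, x \in l' -> F s x.
  have: forall x, x \in l' -> exists n, F n x.
    by move=> x /lspan_mem; rewrite -U.
  elim: l' {U} => [|x l' IHl] Fl'; first by exists 0%N.
  have [n Fn] := Fl' x (mem_head _ _).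
  have [|s Fs] := IHl; first by move=> y yl; apply: Fl'; rewrite inE yl orbT.
  exists (maxn n s) => y /[!inE] /orP[/eqP->|/Fs].
    by apply: Fle Fn; apply: leq_maxl.
  by apply: Fle; apply: leq_maxr.
exists s => n x Fx; apply: lspan_sub Fs _ _ => //; rewrite -U; by exists n.
Qed.

End Noetherian.

(** * Products I W of an ideal and a submodule *)

Section IdealAction.
Variables (R : comPzRingType) (V : lmodType R).
Implicit Types (I m : set R) (W P : set V).

Definition imul I W : set V :=
  addspan [set v | exists a w, [/\ I a, W w & v = a *: w]].

Lemma imul_mem I W a w : I a -> W w -> imul I W (a *: w).
Proof. by move=> Ia Ww; apply: sub_addspan; exists a, w. Qed.

Lemma imul_min I W P :
  is_submod P -> (forall a w, I a -> W w -> P (a *: w)) -> imul I W `<=` P.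
Proof.
by move=> [P0 PD _] IWP; apply: addspan_min => // _ [a [w [Ia Ww ->]]]; apply: IWP.
Qed.

Lemma submod_imul I W : is_submod W -> is_submod (imul I W).
Proof.
move=> [_ _ WZ]; split=> [|x y|b x]; [exact: addspan0|exact: addspanD|].
apply: (@addspan_min _ _ [set x | imul I W (b *: x)]).
- by rewrite /= scaler0; apply: addspan0.
- by move=> y z ? ?; rewrite /= scalerDr; apply: addspanD.
- move=> _ [a [w [Ia Ww ->]]] /=; rewrite scalerA mulrC -scalerA.
  by apply: imul_mem => //; apply: WZ.
Qed.

Lemma imul_sub I I' W W' : I `<=` I' -> W `<=` W' -> imul I W `<=` imul I' W'.
Proof.
move=> sI sW; apply: addspan_min; [exact: addspan0|exact: addspanD|].
by move=> _ [a [w [Ia Ww ->]]]; apply: imul_mem; [apply: sI|apply: sW].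
Qed.

Lemma imul_expS m n W :
  is_submod W -> imul (ideal_exp m n.+1) W = imul m (imul (ideal_exp m n) W).
Proof.
move=> sW; have sW' := submod_imul (ideal_exp m n) sW.
apply/seteqP; split; apply: imul_min; try exact: submod_imul.
  move=> a w + Ww; move: a.
  have [s0 sD _] := submod_imul m sW'.
  apply: (@addspan_min _ _ [set a | imul m (imul (ideal_exp m n) W) (a *: w)]).
  - by rewrite /= scale0r.
  - by move=> x y /= ? ?; rewrite scalerDl; apply: sD.
  - by move=> _ [x [y [mx my ->]]] /=; rewrite -scalerA; do 2!apply: imul_mem => //.
move=> a + ma; apply: (@imul_min _ _ [set w | imul (ideal_exp m n.+1) W (a *: w)]).
  have [s0 sD sZ] := submod_imul (ideal_exp m n.+1) sW.
  split=> [|x y /= ? ?|b x /= ?]; rewrite /= ?scaler0 ?scalerDr //; first exact: sD.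
  by rewrite scalerA mulrC -scalerA; apply: sZ.
move=> b w mb Ww /=; rewrite scalerA; apply: imul_mem => //.
by apply: sub_addspan; exists a, b.
Qed.

(** [imul_expS] peels off the outermost factor m, and this form the innermost
    one, next to W. *)
Lemma imul_expSr m n W :
  is_submod W -> imul (ideal_exp m n.+1) W = imul (ideal_exp m n) (imul m W).
Proof.
move=> sW; elim: n => [|n IHn]; last first.
  rewrite imul_expS // IHn imul_expS //; exact: submod_imul.
apply/seteqP; split; rewrite imul_expS //.
  apply: imul_min => [|a w ma]; first exact/submod_imul/submod_imul.
  move=> Ww; rewrite -(scale1r (a *: w)); apply: imul_mem => //.
  apply: imul_mem => //; apply: imul_min Ww => // b x _ Wx.
  by case: sW => _ _; apply.
apply: imul_min => [|a w _]; first exact/submod_imul/submod_imul.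
have [_ _ sZ] := submod_imul m (submod_imul (ideal_exp m 0) sW).
move=> Ww; apply: sZ; move: w Ww.
apply: imul_min => [|b x mb Wx]; first exact/submod_imul/submod_imul.
apply: imul_mem => //; rewrite -(scale1r x); exact: imul_mem.
Qed.

Lemma ideal_exp_le m k n : (k <= n)%N -> ideal_exp m n `<=` ideal_exp m k.
Proof.
move=> /subnK <-; elim: (n - k)%N => [//|i IHi] x /ideal_expS; exact: IHi.
Qed.

End IdealAction.

Lemma ideal_exp_submod (R : comPzRingType) (m : set R) n :
  is_submod (ideal_exp m n : set R^o).
Proof.
split; [exact: ideal_exp0|exact: ideal_expD|move=> a x; exact: ideal_expM].
Qed.

(** * Artin-Rees and Krull *)

Section Radical.
Variable (R : comPzRingType).
Implicit Types (A m : set R) (l : seq R).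

(** A long product over a finite list must repeat one of the factors often;
    splitting a product by the occurrences of the first generator avoids an
    explicit pigeonhole count. *)
Lemma prod_pow_ideal A l : is_submod (A : set R^o) ->
    (forall a, a \in l -> exists s, A (a ^+ s)) ->
  exists n, forall w, {subset w <= l} -> (n <= size w)%N -> A (\prod_(a <- w) a).
Proof.
move=> [_ _ AM]; elim: l => [_|a l IHl Al].
  by exists 1%N => [[//|b w /(_ b (mem_head _ _))]].
have [s As] := Al a (mem_head _ _).
have [|n An] := IHl; first by move=> b lb; apply: Al; rewrite inE lb orbT.
exists (n + s)%N => w wl nw.
rewrite (bigID (pred1 a)) /=.
have [le_s|lt_s] := leqP s (count_mem a w).
  rewrite mulrC; apply/AM; rewrite (eq_bigr (fun=> a)) => [|i /eqP//].
  rewrite big_const_seq iter_mulr mulr1 -(subnK le_s) exprD; exact: AM.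
apply: AM; rewrite -big_filter; apply: An => [b|].
  rewrite mem_filter => /andP[ba /wl]; by rewrite inE (negPf ba).
rewrite size_filter -(leq_add2r s) (leq_trans nw) //.
by rewrite -(count_predC (pred1 a) w) addnC leq_add2l ltnW.
Qed.

Lemma ideal_exp_prod A l n :
    is_submod (A : set R^o) ->
    (forall w, {subset w <= l} -> size w = n -> A (\prod_(a <- w) a)) ->
  ideal_exp (lspan (l : seq R^o)) n `<=` A.
Proof.
elim: n A => [|n IHn] A sA Al.
  move=> x _; rewrite -[x]mulr1; case: sA => _ _ AZ; apply: (AZ x 1).
  by have:= Al [::]; rewrite big_nil; apply.
have [A0 AD AZ] := sA.
apply: addspan_min => // _ [x [y [+ + ->]]].
move: x; move=> x lx; move: y; apply: IHn.
  split=> [|y z ? ?|a y ?] /=; rewrite ?mulr0 // ?mulrDr; first exact: AD.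
  by rewrite -[a *: y]/(a * y) mulrCA; apply: AZ.
move=> w wl sw /=.
apply: (@lspan_sub _ R^o [set x | A (x * \prod_(a <- w) a)]) lx.
  split=> [|y z ? ?|a y ?] /=; rewrite ?mul0r // ?mulrDl; first exact: AD.
  by rewrite -[a *: y]/(a * y) -mulrA; apply: AZ.
move=> a la /=; have := Al (a :: w); rewrite big_cons; apply; last by rewrite /= sw.
by move=> b /[!inE] /orP[/eqP->|/wl].
Qed.

(** In the application, A is the ideal of the scalars that send a module into a
    submodule, and the hypothesis is available for single elements only. *)
Lemma ideal_exp_radical A l : is_submod (A : set R^o) ->
    (forall a, a \in l -> exists s, A (a ^+ s)) ->
  exists n, ideal_exp (lspan (l : seq R^o)) n `<=` A.
Proof.
move=> sA /(prod_pow_ideal sA)[n An]; exists n; apply: ideal_exp_prod => // w wl sw.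
by apply: An; rewrite ?sw.
Qed.

End Radical.

(** Zorn's lemma is applied to the sets whose union with U is a submodule, so
    that the empty chain needs no separate treatment. *)
Lemma maximal_submod_avoiding (R : comPzRingType) (V : lmodType R) (U Q : set V) :
    is_submod U -> (forall x, U x -> ~ Q x) ->
  exists L, [/\ is_submod L, U `<=` L, forall x, L x -> ~ Q x
    & forall L', is_submod L' -> L `<=` L' -> (forall x, L' x -> ~ Q x) ->
      L' `<=` L].
Proof.
move=> sU UQ; have [U0 UD UZ] := sU.
pose P : set (set V) :=
  [set X | is_submod (X `|` U) /\ forall x, (X `|` U) x -> ~ Q x].
have [A [[sL LQ] Amax]] : exists A, P A /\ forall B, A `<` B -> ~ P B.
  apply: Zorn_bigcup => F FP Ftot; split; last first.
    by move=> x [[X FX Xx]|/UQ//]; have [_] := FP X FX; apply; left.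
  split; first by right.
    move=> x y [[X FX Xx]|Ux] [[Y FY Yy]|Uy].
    - have [Z FZ [Zx Zy]] : exists2 Z, F Z & Z x /\ Z y.
        have [XY|YX] := Ftot X Y FX FY; first by exists Y => //; split=> //; apply: XY.
        by exists X => //; split=> //; apply: YX.
      have [[_ D _] _] := FP Z FZ.
      by have [] := D x y (or_introl Zx) (or_introl Zy); [left; exists Z|right].
    - have [[_ D _] _] := FP X FX.
      by have [] := D x y (or_introl Xx) (or_intror Uy); [left; exists X|right].
    - have [[_ D _] _] := FP Y FY.
      by have [] := D x y (or_intror Ux) (or_introl Yy); [left; exists Y|right].
    - by right; apply: UD.
  move=> a x [[X FX Xx]|Ux]; last by right; apply: UZ.
  have [[_ _ D] _] := FP X FX.
  by have [] := D a x (or_introl Xx); [left; exists X|right].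
exists (A `|` U); split=> // L' sL' LL' L'Q.
have L'U : L' `|` U = L' by apply/setUidPl => x Ux; apply: LL'; right.
have [L'A|NL'A] := EM (L' `<=` A); first by move=> x /L'A; left.
case: (Amax L'); last by split; rewrite L'U.
by split=> // x Ax; apply: LL'; left.
Qed.

Section ArtinRees.
Variables (R : comPzRingType) (m : set R).
Hypotheses (R_noeth : noetherian R) (m_ideal : is_ideal m).

(** Krull's argument, W being the span of l.  Take L maximal among the
    submodules that contain T and meet N only inside T.  For a in m,
    noetherianity stabilises the chain of the submodules {y | a^s y in L}, and for such an s the submodule
    L + a^s W still meets N inside T: if u + a^s y is in N, multiplying by a
    brings it into m N, hence into L, so a^(s+1) y and then a^s y are in L.
    By maximality a^s W is contained in L, hence so is m^n W for n large. *)
Lemma artin_rees_step (V : lmodType R) (l : seq V) (T N : set V) :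
    is_submod T -> is_submod N -> T `<=` N -> imul m N `<=` T ->
  exists n, forall z t,
    N z -> T t -> imul (ideal_exp m n) (lspan l) (z - t) -> T z.
Proof.
move=> sT sN TN mNT; have [T0 TD TZ] := sT.
have [L [sL TL LNT Lmax]] := @maximal_submod_avoiding _ _ T [set x | N x /\ ~ T x]
  sT (fun x Tx => [eta (fun p : N x /\ ~ T x => proj2 p Tx)]).
have [L0 LD LZ] := sL.
have LN x : L x -> N x -> T x by move=> /LNT NT Nx; apply: contrapT => ?; apply: NT.
have [sW0 sWD sWZ] := submod_lspan l.
have pow a : m a -> exists s, forall w, lspan l w -> L (a ^+ s *: w).
  move=> ma; pose F s := [set y | lspan l y /\ L (a ^+ s *: y)].
  have [s|s y [ly Ly]|s y []//|s Fs] := @noetherian_stable _ R_noeth _ l F.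
  - split; first by rewrite /F /= scaler0.
      by move=> x y [? ?] [? ?]; split; rewrite ?scalerDr; [apply: sWD|apply: LD].
    move=> b x [? ?]; split; first exact: sWZ.
    by rewrite scalerA mulrC -scalerA; apply: LZ.
  - by split; rewrite // exprS -scalerA; apply: LZ.
  exists s => w lw.
  pose L' := [set v | exists u y, [/\ L u, lspan l y & v = u + a ^+ s *: y]].
  apply: (Lmax L'); last by exists 0, w; rewrite add0r.
  - split; first by exists 0, 0; rewrite scaler0 addr0.
      move=> _ _ [u [y [? ? ->]]] [v [z [? ? ->]]]; exists (u + v), (y + z).
      by rewrite scalerDr addrACA; split=> //; [apply: LD|apply: sWD].
    move=> b _ [u [y [? ? ->]]]; exists (b *: u), (b *: y).
    rewrite scalerDr !scalerA (mulrC b); split; [exact: LZ|exact: sWZ|by []].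
  - by move=> u Lu; exists u, 0; rewrite scaler0 addr0.
  move=> _ [u [y [Lu ly ->]]] [Nv]; apply.
  have: L (a *: (u + a ^+ s *: y)) by apply/TL/mNT/imul_mem.
  rewrite scalerDr scalerA -exprS => Lau.
  have /Fs[_ Ls] : F s.+1 y.
    split=> //; rewrite -[_ *: y](addKr (a *: u)) addrC.
    by apply: submodB => //; apply: LZ.
  by apply: LN => //; apply: LD.
have /fin_gen_lspan[g mg] : fin_gen (m : set R^o) by apply: R_noeth.
pose B : set R := [set r | forall w, lspan l w -> L (r *: w)].
have sB : is_submod (B : set R^o).
  split=> [w lw|x y Bx By w lw|b x Bx w lw]; first by rewrite scale0r.
    by rewrite scalerDl; apply: LD; [apply: Bx|apply: By].
  by rewrite -[b *: x]/(b * x) -scalerA; apply/LZ/Bx.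
have [a ga|n mnB] := ideal_exp_radical sB (l := g).
  by apply: pow; rewrite mg; apply: lspan_mem.
exists n => z t Nz Tt zt; apply: LN => //.
rewrite -(subrK t z); apply: LD; last exact: TL.
apply: imul_min zt => // a w; rewrite mg => /mnB; exact.
Qed.

(** The m-adic topology of the span of l induces that of N, obtained by applying
    [artin_rees_step] to the successive submodules m^k N.  The inequality
    between k and n is recorded for the users, who compare both topologies. *)
Lemma artin_rees (V : lmodType R) (l : seq V) (N : set V) k :
    is_submod N ->
  exists2 n, (k <= n)%N & forall z,
    N z -> imul (ideal_exp m n) (lspan l) z -> imul (ideal_exp m k) N z.
Proof.
move=> sN; elim: k => [|k [n le_kn ARn]].
  by exists 0%N => // z Nz _; rewrite -(scale1r z); apply: imul_mem.
have sNk j : is_submod (imul (ideal_exp m j) N) by apply: submod_imul.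
have [||n' ARn'] := @artin_rees_step V l _ _ (sNk k.+1) (sNk k).
- by apply: imul_sub => //; apply: ideal_expS.
- by rewrite imul_expS.
exists (maxn k.+1 (maxn n n')); first exact: leq_maxl.
have le := @ideal_exp_le _ m _ _; move=> z Nz zn.
have zle j : (j <= maxn n n')%N -> imul (ideal_exp m j) (lspan l) z.
  move=> jle; apply: imul_sub zn => //; apply: le.
  by rewrite (leq_trans jle) // leq_maxr.
apply: (ARn' z 0).
- by apply: ARn => //; apply: zle; rewrite leq_maxl.
- by case: (sNk k.+1).
- by rewrite subr0; apply: zle; rewrite leq_maxr.
Qed.

End ArtinRees.

Section Krull.
Variables (R : comPzRingType) (m : set R).
Hypotheses (R_noeth : noetherian R) (R_local : local_ring m).

(** Otherwise the ideal generated by 1 - a is contained in a maximal ideal, that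
    is in m, and so 1 = (1 - a) + a is in m. *)
Lemma local_unit a : m a -> exists b, b * (1 - a) = 1.
Proof.
move=> ma; apply: contrapT => Nu; have [[m_ideal mT _] mU] := R_local.
pose U : set R := [set b * (1 - a) | b in setT].
have sU : is_submod (U : set R^o).
  split=> [|_ _ [b _ <-] [c _ <-]|b _ [c _ <-]]; first by exists 0; rewrite ?mul0r.
    by exists (b + c); rewrite ?mulrDl.
  by exists (b * c); rewrite -?[_ *: _]/(b * _) ?mulrA.
have [L [/ideal_submod iL UL L1 Lmax]] :=
  @maximal_submod_avoiding R R^o U [set 1] sU
    (fun x '(ex_intro2 b _ bx) x1 => Nu (ex_intro _ b (etrans bx x1))).
have /mU Lm : maximal_ideal L.
  split=> // [LT|J sJ LJ]; first by apply: (L1 1) => //; rewrite LT.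
  have [J1|NJ1] := EM (J 1); [right|left]; apply/seteqP; split=> //.
    by move=> x _; case: sJ => _ _ /(_ x 1 J1)[]; rewrite mulr1.
  by apply: Lmax => // [|x Jx x1]; [apply/ideal_submod|apply: NJ1; rewrite -[1]x1].
apply: (L1 1) => //; rewrite Lm -(subrK a 1); case: m_ideal => _ mD _; apply: mD => //.
by rewrite -Lm; apply: UL; exists 1; rewrite ?mul1r.
Qed.

(** Krull's intersection theorem in the span of l, modulo P.  The Artin-Rees step for
    P + m x inside P + R x puts x in P + m x, and 1 - a is a unit for a
    in m. *)
Lemma krull (V : lmodType R) (l : seq V) (P : set V) x :
    is_submod P ->
    (forall n, exists2 p, P p & imul (ideal_exp m n) (lspan l) (x - p)) ->
  P x.
Proof.
move=> sP xP; have [P0 PD PZ] := sP; have [[m_ideal _ _] _] := R_local.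
have [m0 mD mM] := m_ideal.
pose N := [set v | exists p r, P p /\ v = p + r *: x].
pose T := [set v | exists p r, [/\ P p, m r & v = p + r *: x]].
have sN : is_submod N.
  split; first by exists 0, 0; rewrite scale0r addr0.
    move=> _ _ [p [r [Pp ->]]] [q [s [Pq ->]]]; exists (p + q), (r + s).
    by rewrite scalerDl addrACA; split=> //; apply: PD.
  move=> a _ [p [r [Pp ->]]]; exists (a *: p), (a * r).
  by rewrite scalerDr scalerA; split=> //; apply: PZ.
have sT : is_submod T.
  split; first by exists 0, 0; rewrite scale0r addr0.
    move=> _ _ [p [r [Pp mr ->]]] [q [s [Pq ms ->]]]; exists (p + q), (r + s).
    by rewrite scalerDl addrACA; split=> //; [apply: PD|apply: mD].
  move=> a _ [p [r [Pp mr ->]]]; exists (a *: p), (a * r).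
  by rewrite scalerDr scalerA; split=> //; [apply: PZ|case: (mM a r mr)].
have [||n AR] := @artin_rees_step _ _ R_noeth m_ideal _ l T N sT sN.
- by move=> _ [p [r [Pp mr ->]]]; exists p, r.
- apply: imul_min => // a _ ma [p [r [Pp ->]]].
  exists (a *: p), (a * r); rewrite scalerDr scalerA; split=> //; first exact: PZ.
  by case: (mM r a ma).
have [p Pp xp] := xP n.
have : T x.
  apply: AR (_ : T p) xp; first by exists 0, 1; rewrite scale1r add0r.
  by exists p, 0; rewrite scale0r addr0.
move=> [q [a [Pq ma xq]]]; have [b b1] := local_unit ma.
rewrite -(scale1r x) -b1 -scalerA; apply: PZ.
by rewrite scalerBl scale1r {1}xq addrK.
Qed.

End Krull.

Lemma imul_lspanP (R : comPzRingType) (V : lmodType R) (I : set R) (l : seq V) v :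
    is_submod (I : set R^o) -> imul I (lspan l) v ->
  exists c : nat -> R, (forall j, I (c j)) /\ v = \sum_(j < size l) c j *: l`_j.
Proof.
move=> [I0 ID IZ]; move: v; apply: imul_min.
  split.
  - by exists (fun=> 0); split=> //; rewrite big1 // => i _; rewrite scale0r.
  - move=> _ _ [c [Ic ->]] [d [Id ->]]; exists (fun i => c i + d i).
    split=> [j|]; first exact: ID.
    by rewrite -big_split; apply: eq_bigr => i _; rewrite scalerDl.
  - move=> a _ [c [Ic ->]]; exists (fun i => a * c i).
    split=> [j|]; first exact: IZ.
    by rewrite scaler_sumr; apply: eq_bigr => i _; rewrite scalerA.
move=> a w Ia /lspanP[c ->]; exists (fun i => a * c i); split=> [j|].
  by rewrite mulrC; apply: IZ.
by rewrite scaler_sumr; apply: eq_bigr => i _; rewrite scalerA.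
Qed.

(** * Terms of an element of the completion *)

Section Components.
Variables (R : comPzRingType) (m : set R).
Local Notation B := (completion m).
Implicit Types (r x y : B).

(** The n-th term of a chosen representative; only its class modulo m^n is
    meaningful. *)
Definition cterm r n : R := val (repr r) n.

Lemma cterm_to_completion (u : cseq m) n :
  ideal_exp m n (cterm (to_completion u) n - val u n).
Proof. exact: repr_to_completion. Qed.

Lemma cterm_cst a n : ideal_exp m n (cterm (completion_cst m a) n - a).
Proof. exact: (cterm_to_completion (cseq_cst m a)). Qed.

Lemma ctermD x y n : ideal_exp m n (cterm (x + y) n - (cterm x n + cterm y n)).
Proof. exact: (cterm_to_completion (cseq_add (repr x) (repr y))). Qed.

Lemma ctermM x y n : ideal_exp m n (cterm (x * y) n - cterm x n * cterm y n).
Proof. exact: (cterm_to_completion (cseq_mul (repr x) (repr y))). Qed.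

Lemma ideal_exp_trans n (a b c : R) :
  ideal_exp m n (a - b) -> ideal_exp m n (b - c) -> ideal_exp m n (a - c).
Proof. by move=> ab bc; rewrite -(subrKA b); apply: ideal_expD. Qed.

Lemma ideal_exp_sym n (a b : R) :
  ideal_exp m n (a - b) -> ideal_exp m n (b - a).
Proof. by move=> ab; rewrite -opprB; apply: ideal_expN. Qed.

Lemma cterm_cstM a x n :
  ideal_exp m n (cterm (completion_cst m a * x) n - a * cterm x n).
Proof.
apply: ideal_exp_trans (ctermM _ _ _) _; rewrite -mulrBl mulrC.
exact/ideal_expM/cterm_cst.
Qed.

Lemma cterm_sum (I : Type) (s : seq I) (F : I -> B) n :
  ideal_exp m n (cterm (\sum_(i <- s) F i) n - \sum_(i <- s) cterm (F i) n).
Proof.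
elim: s => [|i s IHs]; first by rewrite !big_nil; apply: cterm_cst.
rewrite !big_cons; apply: ideal_exp_trans (ctermD _ _ _) _.
by rewrite opprD addrACA subrr add0r.
Qed.

Lemma cterm_eq x y : (forall n, ideal_exp m n (cterm x n - cterm y n)) -> x = y.
Proof.
by move=> xy; rewrite -[x]reprK -[y]reprK; apply/(to_completionP (repr x)).
Qed.

Lemma cterm_le x k n : (k <= n)%N -> ideal_exp m k (cterm x n - cterm x k).
Proof.
move=> /subnK <-; elim: (n - k)%N => [|i IHi].
  by rewrite subrr; apply: ideal_exp0.
apply: ideal_exp_trans IHi; apply: (@ideal_exp_le _ m k (i + k)); first exact: leq_addl.
exact: cseqP.
Qed.

(** The partial sums start at the empty sum, so that the n-th one omits d n, which
    is zero modulo m^n anyway. *)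
Lemma compatible_series (d : nat -> R) :
  (forall n, ideal_exp m n (d n)) -> compatible m (fun n => \sum_(k < n) d k).
Proof. by move=> md n; rewrite big_ord_recr [X in X - _]addrC addrK. Qed.

Lemma completion_series (d : nat -> R) : (forall n, ideal_exp m n (d n)) ->
  exists r, forall n, ideal_exp m n (cterm r n - \sum_(k < n) d k).
Proof.
move=> md; exists (to_completion (Cseq (compatible_series md))) => n.
exact: cterm_to_completion.
Qed.

End Components.

(** * Terms of an element of a tensor product with the completion *)

Section TensorSums.
Variables (R : comPzRingType) (M N : lmodType R).
Local Notation MN := (tensor M N).

Lemma tens0l y : tens 0 y = 0 :> MN.
Proof. by apply: (addrI (tens 0 y)); rewrite -tensDl !addr0. Qed.

Lemma tens0r x : tens x 0 = 0 :> MN.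
Proof. by apply: (addrI (tens x 0)); rewrite -tensDr !addr0. Qed.

Lemma tens_suml (I : Type) (s : seq I) (F : I -> M) y :
  tens (\sum_(i <- s) F i) y = \sum_(i <- s) tens (F i) y :> MN.
Proof.
exact: (big_morph (fun x => tens x y) (fun x x' => tensDl x x' y) (tens0l y)).
Qed.

Lemma tens_sumr (I : Type) (s : seq I) (F : I -> N) x :
  tens x (\sum_(i <- s) F i) = \sum_(i <- s) tens x (F i) :> MN.
Proof. exact: (big_morph (tens x) (tensDr x) (tens0r x)). Qed.

End TensorSums.

Section TensorComponents.
Variables (R : comPzRingType) (m : set R) (M : lmodType R).
Local Notation B := (completion m).
Local Notation MB := (tensor M (alg_mod B)).

(** A representative of the image of the tensor in M / m^n M. *)
Definition tcomp (l : seq (M * alg_mod B)) n : M :=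
  \sum_(p <- l) cterm (p.2 : B) n *: p.1.

(** A derivation of an equality of tensors mentions finitely many elements of
    M, and each of its steps is valid modulo m^n W as soon as W contains them.
    The map from M (x) B to M / m^n M alone would give nothing about a module M that is
    not separated. *)
Lemma tcomp_tens_eq (l l' : seq (M * alg_mod B)) : tens_eq l l' ->
  exists X : seq M, forall W, is_submod W -> (forall x, x \in X -> W x) ->
    forall n, imul (ideal_exp m n) W (tcomp l n - tcomp l' n).
Proof.
have sI n (W : set M) : is_submod W -> is_submod (imul (ideal_exp m n) W).
  exact: submod_imul.
elim=> {l l'}.
- move=> l; exists [::] => W sW _ n; rewrite subrr; by case: (sI n W sW).
- move=> l l' _ [X XP]; exists X => W sW WX n; rewrite -opprB.
  by apply: submodN; [apply: sI|apply: XP].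
- move=> l l' l'' _ [X XP] _ [Y YP]; exists (X ++ Y) => W sW WXY n.
  rewrite -(subrKA (tcomp l' n)); case: (sI n W sW) => _ D _; apply: D.
    by apply: XP => // x Xx; apply: WXY; rewrite mem_cat Xx.
  by apply: YP => // x Xx; apply: WXY; rewrite mem_cat Xx orbT.
- move=> l1 l1' l2 l2' _ [X XP] _ [Y YP]; exists (X ++ Y) => W sW WXY n.
  rewrite /tcomp !big_cat opprD addrACA.
  case: (sI n W sW) => _ D _; apply: D.
    by apply: XP => // x Xx; apply: WXY; rewrite mem_cat Xx.
  by apply: YP => // x Xx; apply: WXY; rewrite mem_cat Xx orbT.
- move=> l l'; exists [::] => W sW _ n.
  by rewrite /tcomp !big_cat /= [X in _ - X]addrC subrr; case: (sI n W sW).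
- move=> y; exists [::] => W sW _ n.
  by rewrite /tcomp big_seq1 big_nil scaler0 subrr; case: (sI n W sW).
- move=> x x' y; exists [::] => W sW _ n.
  rewrite /tcomp !big_cons !big_nil !addr0 scalerDr subrr.
  by case: (sI n W sW).
- move=> x y y'; exists [:: x] => W sW WX n.
  rewrite /tcomp !big_cons !big_nil !addr0 /= -scalerDl -scalerBl.
  by apply: imul_mem; [apply: ctermD|apply/WX/mem_head].
- move=> a x y; exists [:: x] => W sW WX n.
  rewrite /tcomp !big_seq1 /= scalerA -scalerBl.
  apply: imul_mem; last exact/WX/mem_head.
  by rewrite mulrC; apply/ideal_exp_sym/cterm_cstM.
Qed.

Lemma tcomp_eq (l l' : seq (M * alg_mod B)) n :
  to_tensor l = to_tensor l' ->
  imul (ideal_exp m n) setT (tcomp l n - tcomp l' n).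
Proof. by move=> /to_tensorP/tcomp_tens_eq[X]; apply. Qed.

(** The easy half of the equational criterion: a relation over B that is a
    combination of relations over R gives the zero tensor. *)
Lemma sum_tens_relation (I : finType) (J : nat) (e : I -> M) (r : I -> B)
    (b : I -> 'I_J -> R) (y : 'I_J -> B) :
    (forall j, \sum_i b i j *: e i = 0) ->
    (forall i, r i = \sum_j completion_cst m (b i j) * y j) ->
  \sum_i tens (e i) (r i : alg_mod B) = 0 :> MB.
Proof.
move=> be ry.
under eq_bigr => i _.
  rewrite ry tens_sumr; under eq_bigr => j _ do
    rewrite -[completion_cst m (b i j) * y j]/(b i j *: (y j : alg_mod B)) -tensZ.
  over.
rewrite exchange_big big1 // => j _.
by rewrite -tens_suml be tens0l.
Qed.

End TensorComponents.

(** * Faithful flatness of the completion *)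

Section Contraction.
Variables (R : comPzRingType) (m : set R).
Hypotheses (R_noeth : noetherian R) (R_local : local_ring m).
Local Notation B := (completion m).

(** Faithful flatness for arbitrary modules: in the submodule W generated by x
    and by the elements used to prove the equality, x is congruent modulo
    m^n W to an element of P for every n, and Krull's theorem applies. *)
Lemma tensor_contraction (M : lmodType R) (P : set M) x
    (l : seq (M * alg_mod B)) :
    is_submod P -> (forall p, p \in l -> P p.1) ->
    tens x ((1 : B) : alg_mod B) = to_tensor l -> P x.
Proof.
move=> sP Pl /to_tensorP/tcomp_tens_eq[X XP].
have sW := submod_lspan (x :: X).
apply: (krull R_noeth R_local (l := x :: X)) => // n.
exists (tcomp l n).
  rewrite /tcomp big_seq; apply: submod_sum => // p lp.
  by case: sP => _ _; apply; apply: Pl.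
have [_ D _] := submod_imul (ideal_exp m n) sW.
rewrite -(subrKA (tcomp [:: (x, (1 : B) : alg_mod B)] n)); apply: D; last first.
  by apply: XP => // y Xy; apply: lspan_mem; rewrite inE Xy orbT.
rewrite /tcomp big_seq1 /= -[X in X - _]scale1r -scalerBl.
apply: imul_mem; first exact/ideal_exp_sym/cterm_cst.
by move: (lspan_mem (mem_head x X)).
Qed.

End Contraction.

Section Flatness.
Variables (R : comPzRingType) (m : set R).
Hypotheses (R_noeth : noetherian R) (m_ideal : is_ideal m).
Local Notation B := (completion m).

Section FinFun.
Variable (I : finType) (M : lmodType R).

Definition ffun_delta (i : I) (x : M) : {ffun I -> M} :=
  [ffun j => if j == i then x else 0].

Lemma ffun_sum_delta (v : {ffun I -> M}) : v = \sum_i ffun_delta i (v i).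
Proof.
apply/ffunP => j; rewrite sum_ffunE (bigD1 j) //= ffunE eqxx big1 ?addr0 //.
by move=> i /negPf ij; rewrite ffunE eq_sym ij.
Qed.

Lemma ffun_delta_linear i a x y :
  ffun_delta i (a *: x + y) = a *: ffun_delta i x + ffun_delta i y.
Proof.
by apply/ffunP => j; rewrite !ffunE; case: ifP; rewrite ?scaler0 ?addr0.
Qed.

Lemma ffun_delta_submod (W : set {ffun I -> M}) i :
  is_submod W -> is_submod [set x | W (ffun_delta i x)].
Proof.
move=> [W0 WD WZ].
have d0 : ffun_delta i 0 = 0 by apply/ffunP => j; rewrite !ffunE if_same.
split=> [|x y Wx Wy|a x Wx] /=; first by rewrite d0.
  by rewrite -[x]scale1r ffun_delta_linear scale1r; apply: WD.
by rewrite -[a *: x]addr0 ffun_delta_linear d0 addr0; apply: WZ.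
Qed.

Lemma imul_ffun (J : set R) (v : {ffun I -> M}) :
  (forall i, imul J setT (v i)) -> imul J setT v.
Proof.
move=> Jv; rewrite [v]ffun_sum_delta.
apply: submod_sum => [|i _]; first exact: submod_imul.
apply: (@imul_min _ _ J setT [set x | imul J setT (ffun_delta i x)]) (Jv i).
  exact/ffun_delta_submod/submod_imul.
move=> a x Ja _ /=; suff ->: ffun_delta i (a *: x) = a *: ffun_delta i x.
  exact: imul_mem.
by apply/ffunP => j; rewrite !ffunE; case: ifP; rewrite ?scaler0.
Qed.

Lemma ffun_span (l : seq M) : lspan l = setT ->
  lspan [seq ffun_delta i x | i <- enum I, x <- l] = setT.
Proof.
move=> lT; apply/seteqP; split=> // v _; rewrite [v]ffun_sum_delta.
have sL := submod_lspan [seq ffun_delta i x | i <- enum I, x <- l].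
apply: submod_sum => // i _.
apply: (@lspan_sub _ _ _ l (ffun_delta_submod i sL)) => [x lx|].
  by apply: lspan_mem; apply/allpairsP; exists (i, x); rewrite mem_enum.
by rewrite lT.
Qed.

End FinFun.

(** Let L be the module of relations over R between the e i.  By Artin-Rees for
    the span of the e i, the n-th terms of r are close to some g n in L, and by
    Artin-Rees for L the differences between successive g n are small inside
    L, along a subsequence.  So they are combinations of generators of L with
    small coefficients, whose sums converge to the y j. *)
Lemma completion_flat (M : lmodType R) (lM : seq M) (I : finType)
    (e : I -> M) (r : I -> B) :
    lspan lM = setT ->
    (forall n, imul (ideal_exp m n) setT (\sum_i cterm (r i) n *: e i)) ->
  exists J (b : I -> 'I_J -> R) (y : 'I_J -> B),
    (forall j, \sum_i b i j *: e i = 0) /\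
    (forall i, r i = \sum_j completion_cst m (b i j) * y j).
Proof.
move=> lMT er.
pose V : lmodType R := {ffun I -> R^o}.
pose ev (b : V) : M := \sum_i b i *: e i.
have evB b c : ev (b - c) = ev b - ev c.
  by rewrite -sumrB; apply: eq_bigr => i _; rewrite !ffunE scalerBl.
have evD b c : ev (b + c) = ev b + ev c.
  by rewrite -big_split; apply: eq_bigr => i _; rewrite !ffunE scalerDl.
have evZ a b : ev (a *: b) = a *: ev b.
  by rewrite scaler_sumr; apply: eq_bigr => i _; rewrite !ffunE scalerA.
pose L : set V := [set b | ev b = 0].
have sL : is_submod L.
  split=> [|b c bL cL|a b bL]; rewrite /L /=.
  - by rewrite /ev big1 // => i _; rewrite ffunE scale0r.
  - by rewrite evD bL cL addr0.
  - by rewrite evZ bL scaler0.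
set lV := [seq ffun_delta i x | i <- enum I, x <- [:: 1 : R^o]].
have lVT : lspan lV = setT := ffun_span I (lspan_regular R).
have imV k (v : V) : (forall i, ideal_exp m k (v i)) -> imul (ideal_exp m k) setT v.
  move=> mv; apply: imul_ffun => i; rewrite -[v i]mulr1.
  exact: (@imul_mem R R^o).
have [l Ll] : exists l, L = lspan l.
  by apply: (noetherian_submod R_noeth (l := lV)) => // v _; rewrite lVT.
pose u k : V := [ffun i => cterm (r i) k].
(* Artin-Rees in M: the k-th terms of r are, modulo m^k, those of a relation. *)
have /choice[g gP] : forall k, exists g : V,
    L g /\ forall i, ideal_exp m k (cterm (r i) k - g i).
  move=> k; pose lE := [seq e i | i <- enum I].
  have [n le_kn AR] := artin_rees R_noeth m_ideal lM k (submod_lspan lE).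
  have /(imul_lspanP (ideal_exp_submod m k)) [c [mc uc]] :
      imul (ideal_exp m k) (lspan lE) (ev (u n)).
    apply: AR; last by rewrite lMT /ev; under eq_bigr => i _ do rewrite ffunE.
    apply: submod_sum => [|i _]; first exact: submod_lspan.
    have [_ _ Z] := submod_lspan lE; apply: Z; apply: lspan_mem.
    by apply: map_f; rewrite mem_enum.
  pose d : V := [ffun i => c (enum_rank i)].
  have evd : ev d = ev (u n).
    rewrite uc /ev size_map -cardE (reindex_onto (@enum_rank I) (@enum_val I predT)) /=.
      rewrite [RHS](eq_bigl predT) => [|i]; last by rewrite enum_rankK eqxx.
      apply: eq_bigr => i _; rewrite ffunE; congr (_ *: _).
      by rewrite (nth_map i) -?cardE // -enum_val_nth enum_rankK.
    by move=> j _; rewrite enum_valK.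
  exists (u n - d); split; first by rewrite /L /= evB evd subrr.
  move=> i; rewrite !ffunE opprB addrCA addrC; apply: ideal_expD => //.
  exact/ideal_exp_sym/cterm_le.
(* Artin-Rees in R^I: nu k is the precision at which an element of L is in m^k L. *)
have /choice[nu nuP] : forall k, exists n, (k <= n)%N /\ forall z, L z ->
    (forall i, ideal_exp m n (z i)) -> imul (ideal_exp m k) L z.
  move=> k; have [n le_kn AR] := artin_rees R_noeth m_ideal lV k sL.
  by exists n; split=> // z Lz mz; apply: AR => //; rewrite lVT; apply: imV.
(* Sums of the nu j make the precision increase, so that g (mu k) and
   g (mu k.+1) agree modulo m^(nu k). *)
pose mu k := (\sum_(j < k.+1) nu j)%N.
have nu_mu k : (nu k <= mu k)%N by rewrite /mu big_ord_recr /= leq_addl.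
have mu_mu k : (mu k <= mu k.+1)%N.
  by rewrite /mu [X in (_ <= X)%N]big_ord_recr leq_addr.
have /choice[d dP] : forall k, exists d : nat -> R, (forall j, ideal_exp m k (d j)) /\
    g (mu k.+1) - g (mu k) = \sum_(j < size l) d j *: l`_j.
  move=> k; apply: imul_lspanP; first exact: ideal_exp_submod.
  rewrite -Ll; case: (nuP k) => _; apply.
    by apply: submodB => //; case: (gP (mu k)); case: (gP (mu k.+1)).
  move=> i; apply: (ideal_exp_le (nu_mu k)); rewrite !ffunE.
  apply: (@ideal_exp_trans _ m (mu k) _ (cterm (r i) (mu k.+1))).
    apply: ideal_exp_sym; apply: (ideal_exp_le (mu_mu k)).
    by case: (gP (mu k.+1)).
  apply: ideal_exp_trans (cterm_le _ (mu_mu k)) _.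
  by case: (gP (mu k)).
have [c gc] : exists c : nat -> R, g (mu 0%N) = \sum_(j < size l) c j *: l`_j.
  by apply/lspanP; rewrite -Ll; case: (gP (mu 0%N)).
have /choice[s sP] : forall j, exists s : B,
    forall n, ideal_exp m n (cterm s n - \sum_(k < n) d k j).
  move=> j; apply: (completion_series (d := fun k => d k j)) => n.
  by case: (dP n).
have gE n : g (mu n) = \sum_(j < size l) (c j + \sum_(k < n) d k j) *: l`_j.
  elim: n => [|n IHn].
    by rewrite gc; apply: eq_bigr => j _; rewrite big_ord0 addr0.
  rewrite -[LHS](subrK (g (mu n))); case: (dP n) => _ ->; rewrite IHn -big_split.
  apply: eq_bigr => j _ /=; rewrite -scalerDl big_ord_recr /=; congr (_ *: _).
  by rewrite addrCA [X in _ + X]addrC.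
exists (size l), (fun i j => l`_j i),
  (fun j : 'I_(size l) => completion_cst m (c j) + s j).
split=> [j|i].
  by have: L l`_j by rewrite Ll; apply/lspan_mem/mem_nth.
apply: cterm_eq => n.
have le_n : (n <= mu n)%N by apply: leq_trans (nu_mu n); case: (nuP n).
apply: ideal_exp_trans (ideal_exp_sym (cterm_le _ le_n)) _.
apply: ideal_exp_trans (ideal_exp_le le_n (proj2 (gP (mu n)) i)) _.
apply/ideal_exp_sym/(ideal_exp_trans (cterm_sum _ _ _)).
rewrite gE sum_ffunE -sumrB; apply: (submod_sum (W := ideal_exp m n : set R^o)).
  exact: ideal_exp_submod.
move=> j _; rewrite ffunE; apply: ideal_exp_trans (cterm_cstM _ _ _) _.
rewrite -[_ *: _]/(_ * _) [X in _ - X]mulrC -mulrBr; apply: ideal_expM.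
apply: ideal_exp_trans (ctermD _ _ _) _; rewrite opprD addrACA.
by apply: ideal_expD => //; apply: cterm_cst.
Qed.

(** M (x) B is separated: if all terms of a tensor vanish, [completion_flat]
    explains this by relations over R, and these kill the tensor itself. *)
Lemma tensor_separated (M : lmodType R) (lM : seq M) (l : seq (M * alg_mod B)) :
    lspan lM = setT ->
    (forall n, imul (ideal_exp m n) setT (tcomp l n)) ->
  to_tensor l = 0.
Proof.
move=> lMT ml; rewrite to_tensorE big_tnth.
have [n|J [b [y [be ry]]]] :=
  @completion_flat M lM _ (fun i => (tnth (in_tuple l) i).1)
    (fun i => (tnth (in_tuple l) i).2) lMT.
  by have := ml n; rewrite /tcomp big_tnth.
exact: sum_tens_relation be ry.
Qed.

End Flatness.

Lemma imul_map (R : comPzRingType) (V V' : lmodType R) (I : set R)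
    (W : set V) (W' : set V') (f : V -> V') x :
    {morph f : u v / u + v} -> (forall a u, f (a *: u) = a *: f u) ->
    (forall u, W u -> W' (f u)) ->
  imul I W x -> imul I W' (f x).
Proof.
move=> fD fZ fW; move: x.
apply: (@addspan_min _ _ [set x | imul I W' (f x)]).
- by rewrite /= -(scale0r 0) fZ scale0r; apply: addspan0.
- by move=> x y /= ? ?; rewrite fD; apply: addspanD.
- by move=> _ [a [w [Ia Ww ->]]] /=; rewrite fZ; apply: imul_mem => //; apply: fW.
Qed.

(** * The tensor product ring as an algebra over the base *)

Section TensorAlgebra.
Variables (R : comPzRingType) (S : pzAlgType R) (B : comPzAlgType R).
Local Notation T := (alg_tensor S B).

Lemma atensDl s s' b : atens (s + s') b = atens s b + atens s' b :> T.
Proof. exact: tensDl. Qed.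

Lemma atensDr s b b' : atens s (b + b') = atens s b + atens s b' :> T.
Proof. exact: tensDr. Qed.

Lemma atensZ a s b : atens (alg a * s) b = atens s (alg a * b) :> T.
Proof. exact: tensZ. Qed.

Lemma atens0l b : atens 0 b = 0 :> T.
Proof. exact: tens0l. Qed.

Lemma atens0r s : atens s 0 = 0 :> T.
Proof. exact: tens0r. Qed.

Lemma atens_suml (I : Type) (l : seq I) (F : I -> S) b :
  atens (\sum_(i <- l) F i) b = \sum_(i <- l) atens (F i) b :> T.
Proof. exact: tens_suml. Qed.

Lemma atens_sumr (I : Type) (l : seq I) (F : I -> B) s :
  atens s (\sum_(i <- l) F i) = \sum_(i <- l) atens s (F i) :> T.
Proof. exact: tens_sumr. Qed.

Definition tensor_alg (a : R) : T := atens (alg a) 1.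

Fact tensor_alg_zmod_morphism : zmod_morphism tensor_alg.
Proof.
move=> a b; apply: (addIr (tensor_alg b)).
by rewrite subrK -atensDl -rmorphD subrK.
Qed.

HB.instance Definition _ := GRing.isZmodMorphism.Build R T
  tensor_alg tensor_alg_zmod_morphism.

Fact tensor_alg_monoid_morphism : monoid_morphism tensor_alg.
Proof.
split=> [|a b]; first by rewrite /tensor_alg rmorph1.
by rewrite mul_atens mulr1 -rmorphM.
Qed.

HB.instance Definition _ := GRing.isMonoidMorphism.Build R T
  tensor_alg tensor_alg_monoid_morphism.

Fact tensor_algC (a : R) (t : T) : tensor_alg a * t = t * tensor_alg a.
Proof.
elim/alg_tensor_ind: t => [|s b|t t' IH IH'].
- by rewrite mulr0 mul0r.
- by rewrite !mul_atens algC mul1r mulr1.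
- by rewrite mulrDl mulrDr IH IH'.
Qed.

HB.instance Definition _ := isPzAlgebra.Build R T
  (alg := tensor_alg) tensor_algC.

Local Notation TR := (alg_mod T).

Lemma tensor_algE a : tensor_alg a = atens 1 (alg a).
Proof. by rewrite /tensor_alg -[alg a]mulr1 atensZ mulr1. Qed.

Lemma alg_tensor_scaleE a (t : TR) : a *: t = (t : T) * atens 1 (alg a).
Proof. by rewrite -[LHS]/(tensor_alg a * (t : T)) tensor_algC tensor_algE. Qed.

Lemma alg_tensor_scalel a (t : TR) : a *: t = atens (alg a) 1 * (t : T).
Proof. by []. Qed.

Lemma alg_tensor_scaleAl a (t u : T) : (a *: (t : TR) : T) * u = a *: (t * u : TR).
Proof. exact/esym/mulrA. Qed.

Lemma alg_tensor_scaleAr a (t u : T) : t * (a *: (u : TR)) = a *: (t * u : TR).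
Proof. by rewrite !alg_tensor_scaleE mulrA. Qed.

Lemma ideal_submod_alg_mod (A : pzAlgType R) (K : set A) :
  is_ideal K -> is_submod (K : set (alg_mod A)).
Proof. by move=> [K0 KD KM]; split=> // a x Kx; case: (KM (alg a) x Kx). Qed.

End TensorAlgebra.

(** * Idempotent ideals of the completed algebra *)

Section IdempotentFg.
Variables (R : comPzRingType) (m : set R) (S : pzAlgType R).
Hypotheses (R_noeth : noetherian R) (m_ideal : is_ideal m).
Local Notation B := (completion m).
Local Notation T := (alg_tensor S B).
Local Notation TR := (alg_mod T).

(** B = R + m B: the increments of the terms of r after the first one lie in
    m^(n+1) = m m^n, so dividing them by generators of m gives convergent
    series. *)
Lemma completion_residue (r : B) :
  exists a, imul m setT (r - completion_cst m a : alg_mod B).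
Proof.
exists (cterm r 1).
have /fin_gen_lspan[g mg] : fin_gen (m : set R^o) by apply/R_noeth.
have /choice[c cP] : forall n, exists c : nat -> R, (forall j, ideal_exp m n (c j)) /\
    cterm r n.+2 - cterm r n.+1 = \sum_(j < size g) c j *: g`_j.
  move=> n; apply: (@imul_lspanP R R^o); first exact: ideal_exp_submod.
  rewrite -mg; have := @cterm_le _ m r _ _ (leqnSn n.+1).
  move: (cterm r n.+2 - cterm r n.+1).
  apply: (@addspan_min _ _ (@imul R R^o (ideal_exp m n) m)); first exact: addspan0.
    by move=> ? ?; apply: addspanD.
  by move=> _ [x [y [mx my ->]]]; rewrite mulrC; apply: (@imul_mem R R^o).
have /choice[s sP] : forall j, exists s : B,
    forall n, ideal_exp m n (cterm s n - \sum_(k < n) c k j).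
  move=> j; apply: (completion_series (d := fun k => c k j)) => n.
  by case: (cP n).
suff -> : r - completion_cst m (cterm r 1) =
    (\sum_(j < size g) (g`_j : R) *: (s j : alg_mod B) : alg_mod B).
  apply: submod_sum => [|j _]; first exact: submod_imul.
  by apply: imul_mem => //; rewrite mg; apply/lspan_mem/mem_nth.
apply/eqP; rewrite subr_eq; apply/eqP; apply: cterm_eq => n.
apply: ideal_exp_trans (ideal_exp_sym (cterm_le _ (leqnSn n))) _.
apply/ideal_exp_sym/(ideal_exp_trans (ctermD _ _ _)).
rewrite -(subrK (cterm r 1) (cterm r n.+1)) opprD addrACA.
apply: ideal_expD; last exact: cterm_cst.
have -> : cterm r n.+1 - cterm r 1 = \sum_(j < size g) g`_j * \sum_(k < n) c k j.
  under [RHS]eq_bigr => j _ do rewrite mulr_sumr.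
  rewrite exchange_big /=; elim: n => [|n IHn]; first by rewrite big_ord0 subrr.
  rewrite big_ord_recr /= -IHn -(subrK (cterm r n.+1) (cterm r n.+2)) -addrA addrC.
  case: (cP n) => _ ->; congr (_ + _); apply: eq_bigr => j _; exact: mulrC.
apply: ideal_exp_trans (cterm_sum _ _ _) _; rewrite -sumrB.
apply: (submod_sum (W := ideal_exp m n : set R^o)).
  exact: ideal_exp_submod.
move=> j _; apply: ideal_exp_trans (cterm_cstM _ _ _) _.
by rewrite -mulrBr; apply/ideal_expM.
Qed.

Lemma alg_tensor_residue (t : T) :
  exists s, imul m setT (t - atens s 1 : TR).
Proof.
elim/alg_tensor_ind: t => [|s b|t t' [s ts] [s' ts']].
- by exists 0; rewrite atens0l subrr; apply: addspan0.
- have [a ba] := completion_residue b; exists (alg a * s).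
  have -> : atens s b - atens (alg a * s) 1 = atens s (b - completion_cst m a).
    apply/eqP; rewrite subr_eq atensZ -atensDr mulr1.
    by rewrite -[alg a]/(completion_cst m a) subrK.
  apply: (imul_map (f := fun x : alg_mod B => atens s (x : B) : TR)) ba => //.
    by move=> x y; apply: atensDr.
  move=> c x; rewrite alg_tensor_scalel mul_atens mul1r.
  by rewrite atensZ.
- exists (s + s'); rewrite atensDl opprD addrACA; exact: addspanD.
Qed.

Variable (lS : seq (alg_mod S)).
Hypothesis lST : lspan lS = setT.

Let Z n : set T := [set t | imul (ideal_exp m n) [set: alg_mod S] (tcomp (repr t) n)].

Lemma alg_tensor_separated (t : T) : (forall n, Z n t) -> t = 0.
Proof.
by move=> Zt; rewrite -[t]reprK; exact: (tensor_separated R_noeth m_ideal lST Zt).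
Qed.

Let ZE n l : Z n (to_tensor l) <-> imul (ideal_exp m n) setT (tcomp l n).
Proof.
have sI : is_submod (imul (ideal_exp m n) [set: alg_mod S]) by apply: submod_imul.
have e : imul (ideal_exp m n) setT (tcomp (repr (to_tensor l)) n - tcomp l n).
  by apply: tcomp_eq; rewrite [LHS]reprK.
have [_ sD _] := sI; split=> Zl; last first.
  by rewrite /Z /= -(subrK (tcomp l n) (tcomp _ n)); apply: sD.
rewrite -(subrK (tcomp (repr (to_tensor l)) n) (tcomp l n)); apply: sD => //.
by rewrite -opprB; apply: submodN.
Qed.

Let Z0 n : Z n 0.
Proof. by rewrite -[0]/(to_tensor [::]) ZE /tcomp big_nil; apply: addspan0. Qed.

Let ZD n t u : Z n t -> Z n u -> Z n (t + u).
Proof.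
elim/to_tensorW: t => l; elim/to_tensorW: u => l'.
rewrite -[_ + _]/(tens_add _ _) tens_addE !ZE /tcomp big_cat => ? ?.
exact: addspanD.
Qed.

Let ZM n t r : ideal_exp m n (cterm r n) -> Z n (t * atens 1 r).
Proof.
move=> mr; elim/alg_tensor_ind: t => [|s b|t t' Zt Zt'].
- by rewrite mul0r; apply: Z0.
- rewrite mul_atens; apply/(ZE n [:: (_, _)]); rewrite /tcomp big_seq1 /=.
  apply: imul_mem => //; rewrite -[cterm _ _]subr0.
  rewrite -(subrK (cterm b n * cterm r n) (cterm _ _)) -addrA.
  apply: ideal_expD; first exact: ctermM.
  by rewrite subr0; apply: ideal_expM.
- by rewrite mulrDl; apply: ZD.
Qed.

(** Starting from x, subtract successively combinations of l with coefficients in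
    m^n to reach m^(n+1) K.  The coefficients sum up to elements r j of B, and
    the difference of both sides vanishes because T is separated. *)
Lemma complete_nakayama (K : set TR) (l : seq TR) :
    is_submod K ->
    (forall x, K x -> exists2 y, lspan l y & imul m K (x - y)) ->
  forall x, K x -> exists r : nat -> B,
    x = \sum_(j < size l) (l`_j : T) * atens 1 (r j).
Proof.
move=> sK Kl x Kx.
have step n y : exists c : nat -> R, imul (ideal_exp m n) K y ->
    (forall j, ideal_exp m n (c j)) /\
    imul (ideal_exp m n.+1) K (y - \sum_(j < size l) c j *: l`_j).
  have [Ky|NKy] := EM (imul (ideal_exp m n) K y); last by exists (fun=> 0).
  suff [z /(imul_lspanP (ideal_exp_submod m n))[c [mc ->]] ?] :
      exists2 z, imul (ideal_exp m n) (lspan l) z & imul (ideal_exp m n.+1) K (y - z).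
    by exists c.
  have sI k W : is_submod W -> is_submod (imul (ideal_exp m k) W : set TR).
    exact: submod_imul.
  have [s0 sD _] := sI n _ (submod_lspan l); have [k0 kD _] := sI n.+1 _ sK.
  move: y Ky; apply: (@addspan_min _ _ [set y | exists2 z : TR, _ z & _ (y - z)]).
  - by exists 0; rewrite ?subrr.
  - move=> y y' [z lz yz] [z' lz' yz']; exists (z + z'); first exact: sD.
    by rewrite opprD addrACA; apply: kD.
  - move=> _ [a [w [ma /Kl[z lz wz] ->]]]; exists (a *: z); first exact: imul_mem.
    by rewrite -scalerBr imul_expSr //; apply: imul_mem.
have /choice[c cP] : forall p : nat * TR, exists c : nat -> R,
    imul (ideal_exp m p.1) K p.2 -> (forall j, ideal_exp m p.1 (c j)) /\
    imul (ideal_exp m p.1.+1) K (p.2 - \sum_(j < size l) c j *: l`_j).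
  by move=> [n y]; apply: step.
pose X := fix X n := if n is k.+1
  then X k - \sum_(j < size l) c (k, X k) j *: l`_j else x.
have XK n : imul (ideal_exp m n) K (X n).
  elim: n => [|n IHn]; last by case: (cP (n, X n) IHn).
  by rewrite -[X 0%N]scale1r; apply: imul_mem.
pose d n j := c (n, X n) j.
have md n j : ideal_exp m n (d n j) by case: (cP (n, X n) (XK n)) => + _; apply.
have XE n : x = X n + \sum_(j < size l) (\sum_(k < n) d k j) *: l`_j.
  elim: n => [|n IHn].
    by rewrite big1 ?addr0 // => j _; rewrite big_ord0 scale0r.
  rewrite {1}IHn /= -addrA; congr (_ + _).
  rewrite addrC -sumrB; apply: eq_bigr => j _.
  by rewrite -scalerBl big_ord_recr addrK.
have /choice[r rP] : forall j, exists r : B,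
    forall n, ideal_exp m n (cterm r n - \sum_(k < n) d k j).
  by move=> j; apply: (completion_series (d := fun k => d k j)).
exists r; apply/eqP; rewrite -subr_eq0; apply/eqP; apply: alg_tensor_separated => n.
rewrite (XE n) -addrA; apply: ZD.
  move: (X n) (XK n); apply: addspan_min; [exact: Z0|exact: ZD|].
  move=> _ [a [w [ma _ ->]]]; rewrite alg_tensor_scaleE; apply: ZM.
  rewrite -(subrK a (cterm _ n)); apply: ideal_expD => //; exact: cterm_cst.
rewrite -sumrB; apply: (big_ind (Z n)) => [|t u|j _]; [exact: Z0|exact: ZD|].
rewrite alg_tensor_scaleE -mulrBr.
have -> : atens 1 (alg (\sum_(k < n) d k j)) - atens 1 (r j) =
    atens 1 (completion_cst m (\sum_(k < n) d k j) - r j) :> T.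
  by apply/eqP; rewrite subr_eq -atensDr subrK.
apply: ZM; set a := \sum_(k < n) _.
have: ideal_exp m n (cterm (completion_cst m a - r j) n + cterm (r j) n - a).
  apply: ideal_exp_trans (ideal_exp_sym (ctermD _ _ _)) _.
  by rewrite subrK; apply: cterm_cst.
by move=> /ideal_expB /(_ (rP j n)); rewrite -/a opprB addrA subrK addrK.
Qed.

(** The idempotence of K stands for the noetherian property of T.  Choose
    finitely many k s in K that span K modulo m T; writing an element of
    K as a sum of products x y with x, y in K and replacing x by a
    combination of the k s changes it by an element of m T K, that is of m K.
    Hence the products k s (e (x) 1), with e among the generators of S, span
    K modulo m K. *)
Lemma idempotent_ideal_fin_gen (K : set T) : idempotent_ideal K ->
  exists l : seq T, (forall y, y \in l -> K y) /\
    forall x, K x -> exists r : nat -> B, x = \sum_(j < size l) l`_j * atens 1 (r j).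
Proof.
move=> [iK KK]; have [K0 KD KM] := iK; have sK := ideal_submod_alg_mod iK.
have smT : is_submod (imul m [set: TR]) by apply: submod_imul.
have [mT0 mTD mTZ] := smT.
pose L0 : set (alg_mod S) :=
  [set s | exists k, K k /\ imul m setT (k - atens s 1 : TR)].
have [ls L0ls] : exists ls, L0 = lspan ls.
  apply: (noetherian_submod R_noeth (l := lS)); last by rewrite lST.
  split=> [|s s' [k [Kk ks]] [k' [Kk' ks']]|a s [k [Kk ks]]].
  - by exists 0; rewrite atens0l subrr; split; [exact: K0|].
  - exists (k + k'); split; first exact: KD.
    by rewrite atensDl opprD addrACA; apply: mTD.
  - exists (a *: (k : TR)); split; first by case: sK => _ _; apply.
    suff -> : atens (a *: s : alg_mod S) 1 = a *: (atens s 1 : TR).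
      by have := mTZ a _ ks; rewrite scalerBr.
    by rewrite alg_tensor_scalel mul_atens mulr1.
(* L0 consists of the residues of K in S; k lifts them to K. *)
have /choice[k kP] : forall s : alg_mod S, exists k, L0 s ->
    K k /\ imul m setT (k - atens s 1 : TR).
  by move=> s; have [[k ?]|?] := EM (L0 s); [exists k|exists 0].
have lsP (j : 'I_(size ls)) :
    K (k ls`_j) /\ imul m setT (k ls`_j - atens (ls`_j : alg_mod S) 1 : TR).
  by apply: kP; rewrite L0ls; apply/lspan_mem/mem_nth.
have Kmod x : K x -> exists c : nat -> R,
    imul m setT ((x : TR) - \sum_(j < size ls) c j *: (k ls`_j : TR)).
  move=> Kx; have [s xs] := alg_tensor_residue x.
  have /lspanP[c sc] : lspan ls s by rewrite -L0ls; exists x.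
  exists c; rewrite -(subrKA (atens s 1 : TR)); apply: mTD => //.
  have -> : atens s 1 = \sum_(j < size ls) c j *: (atens (ls`_j : alg_mod S) 1 : TR).
    rewrite sc atens_suml; apply: eq_bigr => j _.
    by rewrite alg_tensor_scalel mul_atens mulr1.
  rewrite -sumrB; apply: (submod_sum _ smT) => j _.
  rewrite -scalerBr; apply: mTZ; rewrite -opprB; apply: submodN => //.
  by case: (lsP j).
exists [seq k s * atens (e : S) 1 | s <- ls, e <- lS]; split.
  move=> _ /allpairsP[[s e] [/= lss _ ->]]; case: (kP s) => [|Ks _].
    by rewrite L0ls; apply: lspan_mem.
  by case: (KM (atens (e : S) 1) _ Ks).
set l : seq TR := [seq _ | s <- ls, e <- lS].
have [l0 lD lZ] := submod_lspan l.
pose KR : set TR := K.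
have smK : is_submod (imul m KR) by apply: submod_imul.
have [mK0 mKD mKZ] := smK.
apply: (@complete_nakayama KR l sK).
pose Y : set TR := [set x | exists2 y, lspan l y & imul m KR (x - y)].
have sY : is_submod Y.
  split=> [|x x' [y ly xy] [y' ly' xy']|a x [y ly xy]].
  - by exists 0; rewrite ?subrr.
  - exists (y + y'); first exact: lD.
    by rewrite opprD addrACA; apply: mKD.
  - by exists (a *: y); [apply: lZ|rewrite -scalerBr; apply: mKZ].
have [Y0 YD YZ] := sY.
have mKY x : imul m KR x -> Y x by exists 0; rewrite ?subr0.
suff KY : KR `<=` Y by move=> x /KY.
rewrite /KR -{1}KK; apply: addspan_min => // _ [x [y [Kx Ky ->]]].
have [c xc] := Kmod x Kx.
rewrite -(subrK (\sum_(j < size ls) c j *: (k ls`_j : TR)) x) mulrDl.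
apply: YD.
  apply: mKY.
  apply: (imul_map (f := fun u : TR => (u : T) * y : TR)) xc.
  - by move=> u v; apply: mulrDl.
  - by move=> a u; apply: alg_tensor_scaleAl.
  - by move=> u _; case: (KM u y Ky).
rewrite mulr_suml; apply: (submod_sum _ sY) => j _.
rewrite alg_tensor_scaleAl; apply: YZ.
have [s ys] := alg_tensor_residue y.
rewrite -(subrK (atens s 1) y) addrC mulrDr; case: (sY) => _ + _; apply.
  have /lspanP[e se] : lspan lS s by rewrite lST.
  exists (k ls`_j * atens s 1); last by rewrite subrr.
  rewrite se atens_suml mulr_sumr; apply: (submod_sum _ (submod_lspan l)) => i _.
  have -> : atens (e i *: lS`_i : alg_mod S) 1 =
      e i *: (atens (lS`_i : alg_mod S) 1 : TR).
    by rewrite alg_tensor_scalel mul_atens mulr1.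
  rewrite alg_tensor_scaleAr; apply: lZ; apply: lspan_mem; apply/allpairsP.
  by exists (ls`_j, lS`_i); split=> //; apply: mem_nth.
apply: mKY.
apply: (imul_map (f := fun u : TR => k ls`_j * (u : T) : TR)) ys.
- by move=> u v; apply: mulrDr.
- by move=> a u; apply: alg_tensor_scaleAr.
- by move=> u _; case: (lsP j) => Kk _; case: (KM u _ Kk).
Qed.

End IdempotentFg.

(** * Homomorphisms from a finitely generated module after completion *)

Section Hom.
Variables (R : comPzRingType) (m : set R) (S : pzAlgType R).
Hypotheses (R_noeth : noetherian R) (m_ideal : is_ideal m).
Local Notation B := (completion m).
Local Notation T := (alg_tensor S B).
Variable (lS : seq (alg_mod S)).
Hypothesis lST : lspan lS = setT.
Variables (N : lmodType S^c) (X : seq (restrict N)).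
Hypothesis XT : lspan X = setT.
Variable phi : N -> T.
Hypothesis phiD : {morph phi : x y / x + y}.
Hypothesis phiZ : forall (s : S) x, phi ((s : S^c) *: x) = phi x * atens s 1.

Let p := size X.
Let q := size lS.
Let I : finType := ('I_p * 'I_q)%type.
Let e (k : 'I_q) : S := lS`_k.
Let x (i : 'I_p) : N := X`_i.
Let sig (b : I -> R) (i : 'I_p) : S := \sum_k alg (b (i, k)) * e k.

Let sigP (t : 'I_p -> S) : exists b : {ffun I -> R^o}, forall i, t i = sig b i.
Proof.
have /choice[c cP] : forall s : S, exists c : nat -> R,
    s = \sum_(k < q) alg (c k) * e k.
  move=> s; have /lspanP[c sc] : lspan lS s by rewrite lST.
  by exists c.
exists [ffun ik : 'I_p * 'I_q => c (t ik.1) ik.2] => i; rewrite [LHS]cP.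
by apply: eq_bigr => k _; rewrite ffunE.
Qed.

Let tensP (t : T) : exists r : 'I_q -> B, t = \sum_k atens (e k) (r k).
Proof.
elim/alg_tensor_ind: t => [|s b|t t' [r ->] [r' ->]].
- by exists (fun=> 0); rewrite big1 // => k _; apply: atens0r.
- have /lspanP[c ->] : lspan lS s by rewrite lST.
  exists (fun k => completion_cst m (c k) * b); rewrite atens_suml.
  by apply: eq_bigr => k _; rewrite -atensZ.
- exists (fun k => r k + r' k); rewrite -big_split; apply: eq_bigr => k _.
  by rewrite atensDr.
Qed.

Let Nsum (t : 'I_p -> S) : N := \sum_i (t i : S^c) *: x i.

Let NsumP y : exists t, y = Nsum t.
Proof.
have /lspanP[c ->] : lspan X (y : restrict N) by rewrite XT.
by exists (fun i => alg (c i)).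
Qed.

(** Hom(N, T) = Hom(N, S) (x) B for N finitely presented.  A map from N to S is a
    tuple in S^p killed by the relations between the generators of N, and
    finitely many relations l suffice.  The coordinates of phi on the
    generators of S satisfy a linear system in S^(size l) with solution in
    B, and flatness expresses this solution through solutions in R, that is
    through maps g c. *)
Lemma hom_tensor_presentation :
  exists J (g : 'I_J -> {linear N -> (S^c)^o}) (y : 'I_J -> B),
    forall z, phi z = \sum_c atens (g c z : S) (y c).
Proof.
have phi0 : phi 0 = 0 by apply: (addrI (phi 0)); rewrite -phiD !addr0.
have phi_sum (t : 'I_p -> S) : phi (Nsum t) = \sum_i phi (x i) * atens (t i) 1.
  rewrite /Nsum (big_morph phi phiD phi0); apply: eq_bigr => i _; exact: phiZ.
have /choice[r rP] : forall i, exists r : 'I_q -> B,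
    phi (x i) = \sum_k atens (e k) (r k).
  by move=> i; apply: tensP.
pose L : set {ffun I -> R^o} := [set b | Nsum (sig b) = 0].
have NsumD t t' : Nsum (fun i => t i + t' i) = Nsum t + Nsum t'.
  by rewrite -big_split; apply: eq_bigr => i _; rewrite /= scalerDl.
have NsumM t (s : S) : Nsum (fun i => t i * s) = (s : S^c) *: Nsum t.
  by rewrite scaler_sumr; apply: eq_bigr => i _; rewrite scalerA.
have Nsum_eq t t' : t =1 t' -> Nsum t = Nsum t'.
  by move=> tt'; apply: eq_bigr => i _; rewrite tt'.
have sigD (b c : {ffun I -> R^o}) i : sig (b + c) i = sig b i + sig c i.
  rewrite -big_split; apply: eq_bigr => k _.
  by rewrite /= ffunE -mulrDl -rmorphD.
have sigZ a (b : {ffun I -> R^o}) i : sig (a *: b) i = alg a * sig b i.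
  rewrite mulr_sumr; apply: eq_bigr => k _.
  by rewrite ffunE mulrA -rmorphM.
have sL : is_submod L.
  split=> [|b c bL cL|a b bL]; rewrite /L /=.
  - rewrite /Nsum big1 // => i _; rewrite /sig big1 ?scale0r // => k _.
    by rewrite ffunE raddf0 mul0r.
  - by rewrite (Nsum_eq _ _ (sigD b c)) NsumD bL cL addr0.
  - rewrite (Nsum_eq _ (fun i => sig b i * alg a)); last by move=> i; rewrite sigZ algC.
    by rewrite NsumM bL scaler0.
have [l Ll] : exists l, L = lspan l.
  apply: (noetherian_submod R_noeth
    (l := [seq ffun_delta i x | i <- enum I, x <- [:: 1 : R^o]])) => // v _.
  by rewrite (ffun_span I (lspan_regular R)).
(* Column ik of the system: the values of the generator e of S, placed at
   coordinate i, on each of the relations of l. *)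
pose E (ik : I) : {ffun 'I_(size l) -> alg_mod S} :=
  [ffun j : 'I_(size l) => e ik.2 * sig (l`_j : {ffun I -> R^o}) ik.1 : alg_mod S].
have [n|J [b [y [bE ry]]]] := @completion_flat _ m R_noeth m_ideal _ _ I E
  (fun ik => r ik.1 ik.2) (ffun_span 'I_(size l) lST).
  apply: imul_ffun => j; rewrite sum_ffunE.
  pose lj : seq (alg_mod S * alg_mod B) := [seq (E ik j, r ik.1 ik.2) | ik <- enum I].
  have -> : \sum_i (cterm (r i.1 i.2) n *: E i) j = tcomp lj n - tcomp (m := m) [::] n.
    rewrite /tcomp big_nil subr0 big_map big_enum; apply: eq_bigr => ik _.
    by rewrite ffunE.
  apply: tcomp_eq; rewrite to_tensorE big_map big_enum -[RHS]/(0 : T) /=.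
  have lj0 : Nsum (sig (l`_j : {ffun I -> R^o})) = 0.
    by have : L l`_j by rewrite Ll; apply/lspan_mem/mem_nth.
  transitivity (phi (Nsum (sig (l`_j : {ffun I -> R^o})))); last by rewrite lj0 phi0.
  rewrite phi_sum; under [RHS]eq_bigr => i _ do rewrite rP mulr_suml.
  rewrite pair_bigA; apply: eq_bigr => ik _ /=.
  by rewrite mul_atens mulr1 ffunE.
pose G c i : S := sig (fun ik => b ik c) i.
have GE c (t : 'I_p -> S) : \sum_i G c i * t i =
    \sum_ik alg (b ik c) * (e ik.2 * t ik.1).
  under eq_bigr => i _ do rewrite mulr_suml.
  rewrite pair_big /=; apply: eq_bigr => ik _; rewrite -mulrA.
  by case: ik.
have G0 c (t : 'I_p -> S) : Nsum t = 0 -> \sum_i G c i * t i = 0.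
  have [bt tb] := sigP t; move=> t0.
  have : L bt by rewrite /L /= -t0; apply: Nsum_eq => i; rewrite tb.
  under eq_bigr => i _ do rewrite tb.
  rewrite Ll; apply: (@lspan_sub _ _
    [set bt : {ffun I -> R^o} | \sum_i G c i * sig bt i = 0]).
    split=> [|u v uG vG|a u uG] /=.
    - rewrite big1 // => i _; rewrite /sig big1 ?mulr0 // => k _.
      by rewrite ffunE raddf0 mul0r.
    - under eq_bigr => i _ do rewrite sigD mulrDr.
      by rewrite big_split /= uG vG addr0.
    - under eq_bigr => i _ do rewrite sigZ mulrA -algC -mulrA.
      by rewrite -mulr_sumr uG mulr0.
  move=> bt' /(nthP 0)[j lt_j <-] /=; rewrite GE.
  have /ffunP/(_ (Ordinal lt_j)) := bE c; rewrite sum_ffunE ffunE => bj.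
  by apply: etrans bj; apply: eq_bigr => ik _; rewrite !ffunE.
have /choice[be beP] : forall z, exists t, z = Nsum t by exact: NsumP.
(* Well defined by G0, whatever coordinates be z of z are chosen. *)
pose g c z : S := \sum_i G c i * be z i.
have gE c t z : z = Nsum t -> g c z = \sum_i G c i * t i.
  move=> zt; apply/eqP; rewrite -subr_eq0 -sumrB; apply/eqP.
  under eq_bigr => i _ do rewrite -mulrBr.
  apply: (G0 c (fun i => be z i - t i)).
  rewrite (Nsum_eq _ (fun i => be z i + (t i * -1))); last first.
    by move=> i; rewrite mulrN1.
  rewrite NsumD NsumM -beP -zt.
  have -> : ((-1 : S) : S^c) *: z = - z by exact: (@scaleN1r S^c N z).
  by rewrite subrr.
have g_lin c : GRing.linear_for *:%R (g c : N -> (S^c)^o).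
  move=> s u v; rewrite (gE c (fun i => be u i * s + be v i)); last first.
    by rewrite NsumD NsumM -!beP.
  under eq_bigr => i _ do rewrite mulrDr mulrA.
  by rewrite big_split /= -mulr_suml.
pose gl c := GRing.isLinear.Build _ _ _ _ (g c : N -> (S^c)^o) (g_lin c).
exists J, (fun c => HB.pack_for {linear N -> (S^c)^o} (g c : N -> (S^c)^o) (gl c)), y.
move=> z.
rewrite {1}(beP z) phi_sum.
under eq_bigr => i _ do rewrite rP mulr_suml.
rewrite pair_big /=.
under [RHS]eq_bigr => c _ do
  rewrite -[atens _ _]/(atens (g c z) (y c)) /g GE atens_suml.
rewrite exchange_big /=; apply: eq_bigr => ik _.
rewrite mul_atens mulr1 ry atens_sumr; apply: eq_bigr => c _.
by rewrite atensZ.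
Qed.

End Hom.

(** * Extension of homomorphisms and of ideals *)

Section ExtendHom.
Variables (R : comPzRingType) (S : pzAlgType R) (B : comPzAlgType R).
Variables (N : lmodType S^c) (h : {linear N -> (S^c)^o}).
Local Notation T := (alg_tensor S B).
Local Notation NB := (extend_module B N).

Lemma right_linearZ (s : S) x : h ((s : S^c) *: x) = (h x : S) * s.
Proof. by rewrite linearZ. Qed.

Definition extend_hom (t : NB) : T :=
  tlift (fun (x : restrict N) (b : alg_mod B) => atens (h x : S) (b : B)) t.

Lemma extend_hom_balanced :
  balanced (fun (x : restrict N) (b : alg_mod B) => atens (h x : S) (b : B) : T).
Proof.
split=> [x y b|x b c|a x b]; last 1 first.
- by rewrite [h _]right_linearZ -algC atensZ.
- by rewrite -atensDl; congr atens; apply: raddfD.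
- exact: atensDr.
Qed.
Local Notation bh := extend_hom_balanced.

Lemma extend_hom_mtens x b : extend_hom (mtens x b) = atens (h x : S) b.
Proof. exact: (tlift_tens bh). Qed.

Lemma extend_hom0 : extend_hom 0 = 0.
Proof. exact: (tlift0 bh). Qed.

Lemma extend_homD : {morph extend_hom : t u / t + u}.
Proof. exact: (tliftD bh). Qed.

Lemma extend_homZ (u : T) t : extend_hom ((u : T^c) *: t) = extend_hom t * u.
Proof.
elim/extend_module_ind: t => [|x b|t t' IH IH'].
- by rewrite scaler0 extend_hom0 mul0r.
- elim/alg_tensor_ind: u => [|s c|u u' IH IH'].
  + by rewrite (@scale0r T^c) extend_hom0 mulr0.
  + rewrite [_ *: _]extend_scale_tens !extend_hom_mtens mul_atens.
    by rewrite right_linearZ.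
  + by rewrite (@scalerDl T^c) extend_homD IH IH' mulrDr.
- by rewrite scalerDr [LHS]extend_homD IH IH' extend_homD mulrDl.
Qed.

Lemma extend_hom_is_linear : GRing.linear_for *:%R (extend_hom : NB -> (T^c)^o).
Proof. by move=> u t t'; rewrite extend_homD extend_homZ. Qed.

End ExtendHom.

Section ExtendHomInjective.
Variables (R : comPzRingType) (m : set R) (S : pzAlgType R).
Hypotheses (R_noeth : noetherian R) (m_ideal : is_ideal m).
Local Notation B := (completion m).
Variables (lS : seq (alg_mod S)) (lST : lspan lS = setT).
Variables (N : lmodType S^c) (h : {linear N -> (S^c)^o}).

(** Flatness of B: an element of the kernel gives a relation in S (x) B, which is
    explained by relations over R between the h x, which are
    relations between the x since h is injective. *)
Lemma extend_hom_inj : injective h -> injective (extend_hom (B := B) h).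
Proof.
move=> h_inj t t' tt'; apply/eqP; rewrite -subr_eq0; apply/eqP.
have : extend_hom h (t - t') = 0.
  apply: (addIr (extend_hom h t')).
  by rewrite -extend_homD subrK add0r.
move: (t - t') => {t t' tt'}; elim/to_tensorW=> l.
rewrite !to_tensorE.
have hsum (s : seq (restrict N * alg_mod B)) :
    extend_hom h (\sum_(p <- s) mtens p.1 (p.2 : B)) =
    to_tensor [seq (h p.1 : alg_mod S, p.2) | p <- s].
  rewrite to_tensorE big_map (big_morph _ (extend_homD h) (extend_hom0 _ h)).
  by apply: eq_bigr => p _; apply: extend_hom_mtens.
rewrite [LHS]hsum -[RHS]/(@to_tensor R (alg_mod S) (alg_mod B) [::]) => l0.
have [n|J [b [y [be ry]]]] := @completion_flat _ m R_noeth m_ideal _ lS _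
  (fun i => h (tnth (in_tuple l) i).1 : alg_mod S)
  (fun i => (tnth (in_tuple l) i).2) lST.
  have := tcomp_eq n l0; rewrite /tcomp big_nil subr0 big_map big_tnth.
  exact.
rewrite big_tnth.
apply: (sum_tens_relation (M := restrict N) _ ry) => j.
apply: h_inj; rewrite raddf0 -[RHS](be j) raddf_sum; apply: eq_bigr => i _.
by rewrite [LHS]right_linearZ -algC.
Qed.

End ExtendHomInjective.

Section IdealModule.
Variables (S : pzRingType) (J : set S).

Definition ideal_pred : {pred (S^c)^o} := fun x => `[< J x >].

(** J as a right S-module.  The proof that J is an ideal is a parameter because the
    module structure depends on it. *)
Definition ideal_module (iJ : is_ideal J) := {x : (S^c)^o | x \in ideal_pred}.

Variable iJ : is_ideal J.

Fact ideal_submod_closed : GRing.submod_closed ideal_pred.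
Proof.
have [J0 JD JM] := iJ; split=> [|a x y /asboolP Jx /asboolP Jy]; apply/asboolP => //.
by apply: JD => //; case: (JM a x Jx).
Qed.

HB.instance Definition _ := GRing.isSubmodClosed.Build _ _ ideal_pred
  (GRing.submod_closed_semi ideal_submod_closed).
HB.instance Definition _ := SubType.copy (ideal_module iJ)
  {x : (S^c)^o | x \in ideal_pred}.
HB.instance Definition _ := [Choice of ideal_module iJ by <:].
HB.instance Definition _ := [SubChoice_isSubLmodule of ideal_module iJ by <:].

End IdealModule.

(** * Products of ideals and trace ideals *)

Section Ideals.
Variables (S : pzRingType).
Implicit Types I J K : set S.

Lemma ideal_addspan (A : set S) :
    (forall a x, A x -> addspan A (a * x) /\ addspan A (x * a)) ->
  is_ideal (addspan A).
Proof.
move=> AM; split=> [|x y|a]; [exact: addspan0|exact: addspanD|].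
apply: addspan_min => [|x y [? ?] [? ?]|x Ax]; last exact: AM.
  by rewrite mulr0 mul0r; split; apply: addspan0.
by rewrite mulrDr mulrDl; split; apply: addspanD.
Qed.

Lemma ideal_mul_ideal I J : is_ideal I -> is_ideal J -> is_ideal (ideal_mul I J).
Proof.
move=> [_ _ IM] [_ _ JM]; apply: ideal_addspan => a _ [x [y [Ix Jy ->]]].
split; apply: sub_addspan.
  by exists (a * x), y; rewrite mulrA; split=> //; case: (IM a x Ix).
by exists x, (y * a); rewrite mulrA; split=> //; case: (JM a y Jy).
Qed.

Lemma ideal_mul_subr I J : is_ideal J -> ideal_mul I J `<=` J.
Proof.
move=> [J0 JD JM]; apply: addspan_min => // _ [x [y [_ Jy ->]]].
by case: (JM x y Jy).
Qed.

Lemma trace_ideal_ideal (N : lmodType S^c) : is_ideal (trace_ideal N).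
Proof.
apply: ideal_addspan => a _ [f [x <-]]; split; apply: sub_addspan.
  pose g (y : N) : (S^c)^o := a * (f y : S).
  have g_lin : GRing.linear_for *:%R g.
    move=> s u v; rewrite /g linearP mulrDr; congr (_ + _).
    by rewrite [LHS]mulrA.
  pose gl := GRing.isLinear.Build _ _ _ _ g g_lin.
  by exists (HB.pack_for {linear N -> (S^c)^o} g gl), x.
by exists f, ((a : S^c) *: x); rewrite linearZ.
Qed.

End Ideals.

Section ExtendIdeal.
Variables (R : comPzRingType) (S : pzAlgType R) (B : comPzAlgType R).
Implicit Types J : set S.

Lemma extend_ideal_mul J J' :
  ideal_mul (extend_ideal B J) (extend_ideal B J') `<=`
  extend_ideal B (ideal_mul J J').
Proof.
apply: addspan_min => [||_ [x [y [+ Jy ->]]]]; first exact: addspan0.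
  by move=> ? ?; apply: addspanD.
move: x; apply: addspan_min => [|x x' ? ?|_ [s [b [Js ->]]]].
- by rewrite mul0r; apply: addspan0.
- by rewrite mulrDl; apply: addspanD.
move: y Jy; apply: addspan_min => [|y y' ? ?|_ [s' [b' [Js' ->]]]].
- by rewrite mulr0; apply: addspan0.
- by rewrite mulrDr; apply: addspanD.
rewrite mul_atens; apply: sub_addspan; exists (s * s'), (b * b'); split=> //.
by apply: sub_addspan; exists s, s'.
Qed.

Lemma extend_ideal_min J (K : set (alg_tensor S B)) :
  is_ideal K -> (forall s, J s -> K (atens s 1)) -> extend_ideal B J `<=` K.
Proof.
move=> [K0 KD KM] JK; apply: addspan_min => // _ [s [b [Js ->]]].
have -> : atens s b = atens s 1 * atens 1 b by rewrite mul_atens mulr1 mul1r.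
by case: (KM (atens 1 b) _ (JK s Js)).
Qed.

End ExtendIdeal.

Section Contraction.
Variables (R : comPzRingType) (m : set R).
Hypotheses (R_noeth : noetherian R) (R_local : local_ring m).
Local Notation B := (completion m).

Lemma tensor_span_contraction (M : lmodType R) (P : set M) x : is_submod P ->
    addspan [set t | exists y (b : alg_mod B), P y /\ t = tens y b]
      (tens x ((1 : B) : alg_mod B)) ->
  P x.
Proof.
move=> sP xP; suff [l [lP xl]] : exists l : seq (M * alg_mod B),
    (forall p, p \in l -> P p.1) /\ tens x ((1 : B) : alg_mod B) = to_tensor l.
  exact: (tensor_contraction R_noeth R_local sP lP xl).
move: (tens x _) xP; apply: addspan_min => [|t u [l [lP ->]] [l' [lP' ->]]|].
- by exists [::].
- exists (l ++ l'); split; last by rewrite -tens_addE.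
  by move=> p; rewrite mem_cat => /orP[/lP|/lP'].
- by move=> _ [y [b [Py ->]]]; exists [:: (y, b)]; split=> // p /[!inE] /eqP ->.
Qed.

Lemma extend_ideal_contraction (S : pzAlgType R) (J : set S) s :
  is_ideal J -> extend_ideal B J (atens s 1) -> J s.
Proof.
move=> /ideal_submod_alg_mod sJ.
exact: (@tensor_span_contraction (alg_mod S) J s sJ).
Qed.

Lemma extend_ideal_sub (S : pzAlgType R) (J J' : set S) : is_ideal J' ->
  extend_ideal B J `<=` extend_ideal B J' -> J `<=` J'.
Proof.
move=> iJ' JJ' s Js; apply: extend_ideal_contraction => //; apply: JJ'.
by apply: sub_addspan; exists s, 1.
Qed.

End Contraction.

(** * Idempotent ideals extended from modules *)

Section Main.
Variables (R : comPzRingType) (m : set R) (S : pzAlgType R).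
Hypotheses (R_noeth : noetherian R) (R_local : local_ring m).
Local Notation B := (completion m).
Local Notation T := (alg_tensor S B).
Variables (lS : seq (alg_mod S)) (lST : lspan lS = setT).
Variable (K : set T).
Hypothesis K_idem : idempotent_ideal K.

Let m_ideal : is_ideal m. Proof. by case: R_local => -[]. Qed.
Let K_ideal : is_ideal K. Proof. by case: K_idem. Qed.

Lemma ideal_iso_extend_ideal (J : set S) : is_ideal J ->
  exists N : lmodType S^c, ideal_iso (extend_ideal B J) (extend_module B N).
Proof.
move=> iJ; exists (ideal_module iJ : lmodType S^c).
pose h : {linear ideal_module iJ -> (S^c)^o} := val.
pose f := HB.pack_for {linear extend_module B (ideal_module iJ) -> (T^c)^o}
  (extend_hom h : extend_module B (ideal_module iJ) -> (T^c)^o)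
  (GRing.isLinear.Build _ _ _ _ _ (extend_hom_is_linear (B := B) h)).
exists f; split.
  apply: (extend_hom_inj R_noeth m_ideal lST); exact: val_inj.
move=> y; split=> [|[t <-]].
  move: y; apply: addspan_min => [|_ _ [t <-] [u <-]|_ [s [b [Js ->]]]].
  - by exists 0; rewrite raddf0.
  - by exists (t + u); rewrite raddfD.
  - have Js' : (s : (S^c)^o) \in ideal_pred J by apply/asboolP.
    exists (mtens (Sub (s : (S^c)^o) Js' : ideal_module iJ) b).
    by rewrite [LHS]extend_hom_mtens.
elim/extend_module_ind: t => [|x b|t u IHt IHu].
- by rewrite raddf0; apply: addspan0.
- rewrite [f _]extend_hom_mtens; apply: sub_addspan; exists (h x : S), b; split=> //.
  exact/asboolP/(valP x).
- by rewrite raddfD; apply: addspanD.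
Qed.

Variables (N : lmodType S^c) (f : {linear extend_module B N -> (T^c)^o}).
Hypotheses (f_inj : injective f) (f_im : forall y : T, K y <-> exists x, f x = y).

Let fZ (u : T) t : f ((u : T^c) *: t) = (f t : T) * u.
Proof. by rewrite linearZ. Qed.

Let f_mtens x b : (f (mtens x b) : T) = (f (mtens x 1) : T) * atens 1 b.
Proof.
by rewrite -fZ; congr (f _); rewrite [RHS]extend_scale_tens scale1r mul1r.
Qed.

(** K is spanned over B by finitely many f t, and each t involves finitely many
    elements of N.  Let X collect them; then x (x) 1 lies in the span of
    X (x) B for every x in N, and contraction puts x in the span of X. *)
Lemma extended_fin_gen : exists X : seq (restrict N), lspan X = setT.
Proof.
have [l [lK Kl]] := idempotent_ideal_fin_gen R_noeth m_ideal lST K_idem.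
have /choice[t tP] : forall y : T, exists t, K y -> f t = y.
  by move=> y; have [/f_im[t <-]|?] := EM (K y); [exists t|exists 0].
pose X : seq (restrict N) := flatten [seq [seq p.1 | p <- repr (t y)] | y <- l].
exists X; apply/seteqP; split=> // x _.
apply: (tensor_span_contraction R_noeth R_local (submod_lspan X)).
set Q := addspan _.
have Q0 : Q 0 by apply: addspan0.
have QD a b : Q a -> Q b -> Q (a + b) by apply: addspanD.
have QZ (r : B) (a : extend_module B N) : Q a -> Q ((atens 1 r : T^c) *: a).
  move: a; apply: addspan_min => [|a b Qa Qb|_ [y [b [Xy ->]]]].
  - by rewrite scaler0.
  - by rewrite scalerDr; apply: QD.
  - rewrite [_ *: _](extend_scale_tens (y : N) b 1 r) scale1r.
    by apply: sub_addspan; exists y, ((b : B) * r).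
have Qt y : y \in l -> Q (t y).
  move=> ly; rewrite -(reprK (t y) : to_tensor (repr (t y)) = t y) to_tensorE.
  rewrite big_seq; apply: (big_ind Q) => // p yp; apply: sub_addspan.
  exists p.1, p.2; split=> //; apply: lspan_mem; apply/flattenP.
  by exists [seq p.1 | p <- repr (t y)]; apply: map_f.
have Kx : K (f (mtens x 1)) by apply/f_im; exists (mtens x 1).
have [r xr] := Kl _ Kx.
rewrite -[tens _ _]/(mtens (x : N) (1 : B)).
have -> : mtens x 1 = \sum_(j < size l) (atens 1 (r j) : T^c) *: t l`_j.
  apply: f_inj; rewrite raddf_sum xr; apply: eq_bigr => j _.
  by rewrite [RHS]fZ tP //; apply/lK/mem_nth.
by apply: (big_ind Q) => // j _; apply/QZ/Qt/mem_nth.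
Qed.

Lemma ideal_sub_extend_trace : K `<=` extend_ideal B (trace_ideal N).
Proof.
have [X XT] := extended_fin_gen.
pose phi (x : N) : T := f (mtens x 1).
have phiD : {morph phi : x y / x + y}.
  move=> x y; rewrite /phi -[RHS](raddfD f); congr (f _); exact: tensDl.
have phiZ (s : S) x : phi ((s : S^c) *: x) = phi x * atens s 1.
  by rewrite /phi -fZ; congr (f _); rewrite [RHS]extend_scale_tens mulr1.
have [J [g [y gy]]] := hom_tensor_presentation R_noeth m_ideal lST XT phiD phiZ.
have E0 : extend_ideal B (trace_ideal N) 0 by apply: addspan0.
have ED t u : extend_ideal B (trace_ideal N) t -> extend_ideal B (trace_ideal N) u ->
    extend_ideal B (trace_ideal N) (t + u) by apply: addspanD.
move=> k /f_im[t <-] {k}; elim/extend_module_ind: t => [|x b|t u IHt IHu].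
- by rewrite raddf0.
- rewrite f_mtens -/(phi x) gy mulr_suml.
  apply: (big_ind (extend_ideal B (trace_ideal N))) => // c _.
  rewrite mul_atens mulr1; apply: sub_addspan; exists (g c x : S), (y c * b).
  by split=> //; apply: sub_addspan; exists (g c), x.
- by rewrite raddfD; apply: ED.
Qed.

(** For h : N -> S, transport h (x) B along f to a right T-linear map from K
    to T.  It sends a product k k' with k, k' in K to a left multiple of
    k', and K = K K. *)
Lemma extend_trace_sub_ideal : extend_ideal B (trace_ideal N) `<=` K.
Proof.
have [K0 KD KM] := K_ideal; have [_ KK] := K_idem.
apply: extend_ideal_min => // s; move: s.
apply: (@addspan_min _ _ [set s : S | K (atens s 1)]).
- by rewrite /= atens0l.
- by move=> s s' Ks Ks'; rewrite /= atensDl; apply: KD.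
move=> _ [h [x <-]] /=; rewrite -(extend_hom_mtens h).
have : ideal_mul K K (f (mtens x 1)) by rewrite KK; apply/f_im; exists (mtens x 1).
pose P (k : T) := exists2 t, f t = k & K (extend_hom h t).
move=> xKK; suff [t /f_inj <-] : P (f (mtens x 1)) by [].
move: (f _) xKK; apply: addspan_min => [|_ _ [t <- Kt] [u <- Ku]|].
- by exists 0; rewrite ?raddf0 ?extend_hom0.
- by exists (t + u); rewrite ?raddfD // extend_homD; apply: KD.
- move=> _ [_ [k [/f_im[t <-] Kk ->]]]; exists ((k : T^c) *: t).
    by rewrite fZ.
  by rewrite extend_homZ; case: (KM (extend_hom h t) k Kk).
Qed.

Lemma extend_trace_ideal : extend_ideal B (trace_ideal N) = K.
Proof.
by apply/seteqP; split; [exact: extend_trace_sub_ideal|exact: ideal_sub_extend_trace].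
Qed.

Lemma trace_ideal_idempotent : idempotent_ideal (trace_ideal N).
Proof.
have iN := trace_ideal_ideal N; split=> //.
apply/seteqP; split; first exact: ideal_mul_subr.
apply: (extend_ideal_sub R_noeth R_local); first exact: ideal_mul_ideal.
rewrite extend_trace_ideal; have [_ {1}<-] := K_idem.
by rewrite -extend_trace_ideal; apply: extend_ideal_mul.
Qed.

Lemma idempotent_extends_iff_trace (J : set S) :
  (idempotent_ideal J /\ extend_ideal B J = K) <-> J = trace_ideal N.
Proof.
split=> [[[iJ _] JK]|->]; last first.
  by split; [exact: trace_ideal_idempotent|exact: extend_trace_ideal].
apply/seteqP; split; apply: (extend_ideal_sub R_noeth R_local) => //.
- exact: trace_ideal_ideal.
- by rewrite JK extend_trace_ideal.
- by rewrite JK extend_trace_ideal.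
Qed.

End Main.

Theorem proposition10p7 (R : comPzRingType) (m : set R) (S : pzAlgType R)
    (R_local : local_ring m) (R_noetherian : noetherian R)
    (S_finite : module_finite S)
    (K : set (alg_tensor S (completion m))) (K_idem : idempotent_ideal K) :
  ((exists N : lmodType S^c, ideal_iso K (extend_module (completion m) N)) <->
   (exists J : set S,
      idempotent_ideal J /\ extend_ideal (completion m) J = K)) /\
  (forall N : lmodType S^c, ideal_iso K (extend_module (completion m) N) ->
   forall J : set S,
     (idempotent_ideal J /\ extend_ideal (completion m) J = K) <->
     J = trace_ideal N).
Proof.
have [lS /esym lST] := fin_gen_lspan S_finite.
have traceP (N : lmodType S^c) : ideal_iso K (extend_module (completion m) N) ->
    forall J : set S, (idempotent_ideal J /\ extend_ideal (completion m) J = K) <->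
    J = trace_ideal N.
  move=> [f [f_inj f_im]] J.
  exact: (idempotent_extends_iff_trace R_noetherian R_local lST K_idem f_inj f_im).
split=> //; split=> [[N /traceP NJ]|[J [[iJ _] <-]]].
  by exists (trace_ideal N); apply/NJ.
exact: (ideal_iso_extend_ideal R_noetherian R_local lST iJ).
Qed.
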